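(* Let $\mathbf{a}=(a_i)_{i=1}^\infty$ and $\mathbf{b}=(b_i)_{i=1}^\infty$ be sequences of integers such that $$0=a_1\leq b_1<a_2<b_2<\cdots<a_i<b_i<\cdots.$$ Let $X'(\mathbf{a},\mathbf{b})$ be the subset of $[0,1]$ consisting of all those numbers $x$ with an infinite binary expansion $x=\sum_{n=1}^\infty\xi_n2^{-n}$, $\xi_n\in\{0,1\}$, satisfying the condition $$\xi_{b_i+1}=\xi_{b_i+2}=\cdots=\xi_{a_{i+1}},\qquad i=1,2,3,\ldots.$$ Then: 1. $$\dim_{\mathrm H}X'(\mathbf{a},\mathbf{b})=\underline{\dim}_{\mathrm{MB}}X'(\mathbf{a},\mathbf{b})=\underline{\dim}_{\mathrm B}X'(\mathbf{a},\mathbf{b})=\liminf_{k\to\infty}\frac{\sum_{i=1}^k(b_i-a_i+1)}{a_{k+1}}.$$ 2. $$\dim_{\mathrm P}X'(\mathbf{a},\mathbf{b})=\overline{\dim}_{\mathrm{MB}}X'(\mathbf{a},\mathbf{b})=\overline{\dim}_{\mathrm B}X'(\mathbf{a},\mathbf{b})=\limsup_{k\to\infty}\frac{\sum_{i=1}^k(b_i-a_i+1)}{b_k}.$$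
   Context: Convention on binary expansions: digit sequences that are eventually $0$ are allowed, so $X'(\mathbf{a},\mathbf{b})$ is the set of all sums $\sum_{n\ge1}\xi_n2^{-n}$ with $\xi_n\in\{0,1\}$ satisfying the stated condition. $\dim_{\mathrm H}$ denotes Hausdorff dimension. For a non-empty bounded set $F\subseteq\mathbb{R}$ and $\varepsilon>0$, let $N_\varepsilon(F)$ be the smallest number of sets of diameter at most $\varepsilon$ which can cover $F$. The lower and upper box dimensions are $$\underline{\dim}_{\mathrm B}F=\liminf_{\varepsilon\to0}\frac{\log N_\varepsilon(F)}{-\log\varepsilon},\qquad \overline{\dim}_{\mathrm B}F=\limsup_{\varepsilon\to0}\frac{\log N_\varepsilon(F)}{-\log\varepsilon}.$$ The modified lower and upper box dimensions are $$\underline{\dim}_{\mathrm{MB}}F=\inf\Big\{\sup_i\underline{\dim}_{\mathrm B}F_i : F\subseteq\bigcup_{i=1}^\infty F_i\Big\},\qquad \overline{\dim}_{\mathrm{MB}}F=\inf\Big\{\sup_i\overline{\dim}_{\mathrm B}F_i : F\subseteq\bigcup_{i=1}^\infty F_i\Big\},$$ the infima being over all countable covers of $F$ by non-empty bounded sets. $\dim_{\mathrm P}$ denotes the standard packing dimension: for $s\ge0$, let $\mathcal{P}^s_\delta(F)$ be the supremum of $\sum_i|B_i|^s$ over countable collections of disjoint balls $B_i$ of radii at most $\delta$ with centers in $F$ ($|B_i|$ being the diameter), $\mathcal{P}^s_0(F)=\lim_{\delta\to0}\mathcal{P}^s_\delta(F)$, $\mathcal{P}^s(F)=\inf\{\sum_i\mathcal{P}^s_0(F_i):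 F\subseteq\bigcup_{i=1}^\infty F_i\}$, and $\dim_{\mathrm P}F=\inf\{s:\mathcal{P}^s(F)=0\}$. *)

(* Defs.v *)
From mathcomp Require Export all_boot all_order all_algebra.
From mathcomp Require Export all_classical all_reals all_analysis.

Set Implicit Arguments.
Unset Strict Implicit.
Unset Printing Implicit Defensive.

Export Order.TTheory GRing.Theory Num.Theory.
Export numFieldNormedType.Exports.

Local Open Scope classical_set_scope.
Local Open Scope ring_scope.
Local Open Scope ereal_scope.

(* The maximum with 0 only matters for the empty set, whose diameter is 0
   instead of ereal_sup set0 = -oo. *)
Definition diameter (R : realType) (A : set R) : \bar R :=
  maxe 0 (@ereal_sup R [set `|x.1 - x.2|%:E | x in A `*` A]).

(* In the definitions of Hausdorff and packing measures, a countable collection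
   is a family indexed by some D : set nat, so that finite collections are
   included. Since 0 `^ 0 = 1, a one-point set contributes 1 when s = 0. *)

Definition hausdorff_premeasure (R : realType) (s : R) (F : set R) (delta : R)
    : \bar R :=
  ereal_inf [set t | exists (D : set nat) (U : nat -> set R),
    [/\ F `<=` \bigcup_(i in D) U i,
        forall i, D i -> diameter (U i) <= delta%:E &
        t = \esum_(i in D) (diameter (U i) `^ s)]].

Definition hausdorff_measure (R : realType) (s : R) (F : set R) : \bar R :=
  lim (hausdorff_premeasure s F delta @[delta --> (0:R)^'+]).

Definition hausdorff_dim (R : realType) (F : set R) : \bar R :=
  ereal_inf [set s%:E | s in [set s : R | (0 <= s)%R /\
                                          hausdorff_measure s F = 0]].

(* The infimum of the empty set is 0, so this is meaningful for bounded F
   and eps > 0 only; it is then a minimum, attained at some n : nat. *)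
Definition covering_number (R : realType) (F : set R) (eps : R) : R :=
  inf [set n%:R | n in [set n : nat | exists U : nat -> set R,
    F `<=` \bigcup_(i < n) U i /\
    forall i, (i < n)%N -> diameter (U i) <= eps%:E]].

Definition box_ratio (R : realType) (F : set R) (eps : R) : \bar R :=
  (ln (covering_number F eps) / - ln eps)%:E.

Definition lower_box_dim (R : realType) (F : set R) : \bar R :=
  limf_einf (box_ratio F) (0:R)^'+.

Definition upper_box_dim (R : realType) (F : set R) : \bar R :=
  limf_esup (box_ratio F) (0:R)^'+.

Definition modified_dim (R : realType) (dim : set R -> \bar R) (F : set R)
    : \bar R :=
  ereal_inf [set ereal_sup (range (fun i => dim (G i))) |
    G in [set G : nat -> set R |
      F `<=` \bigcup_i G i /\ forall i, G i !=set0 /\ bounded_set (G i)]].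

Definition lower_modified_box_dim (R : realType) (F : set R) : \bar R :=
  modified_dim (@lower_box_dim R) F.

Definition upper_modified_box_dim (R : realType) (F : set R) : \bar R :=
  modified_dim (@upper_box_dim R) F.

Definition packing_premeasure_at (R : realType) (s : R) (F : set R) (delta : R)
    : \bar R :=
  ereal_sup [set t | exists (D : set nat) (c r : nat -> R),
    [/\ forall i, D i -> F (c i) /\ (0 < r i <= delta)%R,
        trivIset D (fun i => closed_ball (c i) (r i)) &
        t = \esum_(i in D) (diameter (closed_ball (c i) (r i)) `^ s)]].

Definition packing_premeasure (R : realType) (s : R) (F : set R) : \bar R :=
  lim (packing_premeasure_at s F delta @[delta --> (0:R)^'+]).

Definition packing_measure (R : realType) (s : R) (F : set R) : \bar R :=
  ereal_inf [set \sum_(0 <= i <oo) packing_premeasure s (G i) |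
    G in [set G : nat -> set R | F `<=` \bigcup_i G i]].

Definition packing_dim (R : realType) (F : set R) : \bar R :=
  ereal_inf [set s%:E | s in [set s : R | (0 <= s)%R /\
                                          packing_measure s F = 0]].

Local Close Scope ereal_scope.

(* Sequences are indexed from 1; their values at 0 are not used. *)

Definition binary_sum (R : realType) (xi : nat -> bool) : R :=
  limn (fun N : nat => \sum_(1 <= n < N) ((xi n)%:R / 2 ^+ n) : R).

Definition constant_blocks (a b : nat -> int) (xi : nat -> bool) : Prop :=
  forall i : nat, (1 <= i)%N -> forall m n : nat,
    b i < m%:Z <= a i.+1 -> b i < n%:Z <= a i.+1 -> xi m = xi n.

Definition Xprime (R : realType) (a b : nat -> int) : set R :=
  [set x | exists2 xi : nat -> bool, constant_blocks a b xi &
                                     x = binary_sum R xi].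

Arguments Xprime : clear implicits.

Definition free_digits (a b : nat -> int) (k : nat) : int :=
  \sum_(1 <= i < k.+1) (b i - a i + 1).

(* Main.v *)
Require Import Defs.
From mathcomp Require Import zify ring lra.

(** Let [phi n] be the number of free choices among the first [n] digits: it
    grows by one at each digit that is not forced to repeat the preceding one.
    A point of the set is a sum of [z (phi n) / 2 ^ n], where [z] is an
    arbitrary sequence of bits, and everything that matters about the set is
    the function [phi]: at scale [2 ^- n] it consists of at most [2 ^ phi n]
    pieces, one for each choice of the first [phi n] bits of [z].

    Lower bounds come from a single mass. Reading the bits [z] off a uniformly
    distributed point [u] of the unit interval pushes Lebesgue outer measure
    forward to an outer measure [code_mass phi] of total mass 1, under which a
    set of diameter at most [2 ^- n] has mass at most [5 / 2 ^ phi n]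
    ([code_mass_small]): its points have at most five possible values of their
    first [n] digits, and these digits determine the first [phi n] bits of
    [u]. Being an outer measure, it applies to the arbitrary sets that occur
    in covers, and one member of each countable cover has positive mass. Any
    set [G] of positive mass then needs about [2 ^ phi n] sets of diameter
    [2 ^- n] to be covered, which bounds its box dimensions from below
    ([ln_covering_number_ge]), and contains about as many points separated by
    [2 ^- n.+1] ([separated_points]), which makes its packing premeasures
    large ([packing_premeasure_at_ge1]). For Hausdorff measure this is the
    mass distribution principle ([code_mass_le_powR]).

    Upper bounds for the Hausdorff and box dimensions come from the
    [2 ^ phi n] pieces. For the packing dimension, each ball of radius about
    [2 ^- n] centred in the set contains all the points coded by a dyadic
    interval of length [2 ^- phi n.+1]; disjoint balls give disjoint intervals
    of total length at most 1 ([packing_premeasure_at_le]).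

    Hence the three lower dimensions are the lower limit of [phi n / n] and
    the three upper ones its upper limit ([coded_lower_dims],
    [coded_upper_dims]). Finally [phi] has slope 1 on the free blocks and 0 on
    the repeated ones, so [phi n / n], which never exceeds 1, is smallest at
    the ends [a k.+1] of the repeated blocks and largest, up to a bounded
    change of [phi], at the ends [b k] of the free ones. *)

Set Implicit Arguments.
Unset Strict Implicit.
Unset Printing Implicit Defensive.

Local Open Scope classical_set_scope.
Local Open Scope ring_scope.

(** * Prefixes of binary expansions *)

(** The integer whose binary writing is [xi 1 ... xi n]: comparing the first
    [n] digits of two sequences amounts to comparing these integers. *)
Fixpoint prefix_val (xi : nat -> bool) (n : nat) : nat :=
  if n is m.+1 then ((prefix_val xi m).*2 + xi n)%N else 0%N.

Lemma prefix_val_lt xi n : (prefix_val xi n < 2 ^ n)%N.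
Proof. by elim: n => //= n IH; rewrite expnS; case: (xi n.+1); lia. Qed.

Lemma eq_prefix_val xi eta n :
  prefix_val xi n = prefix_val eta n <-> forall j, (1 <= j <= n)%N -> xi j = eta j.
Proof.
elim: n => [|n IH] /=; first by split=> // _ j; lia.
split=> [e j jn | e].
- have [ew ed] : prefix_val xi n = prefix_val eta n /\ xi n.+1 = eta n.+1.
    by move: e; case: (xi n.+1); case: (eta n.+1) => /= ?; split=> //; lia.
  have [->//|jn1] := eqVneq j n.+1.
  by move/IH: ew; apply; lia.
- by rewrite e ?leqnn//; congr (_.*2 + _)%N; apply/IH => j jn; apply: e; lia.
Qed.

Lemma partial_binary_sum (R : realType) (xi : nat -> bool) n :
  \sum_(1 <= i < n.+1) ((xi i)%:R / 2 ^+ i) = (prefix_val xi n)%:R / 2 ^+ n :> R.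
Proof.
elim: n => [|n IH]; first by rewrite big_geq// mul0r.
rewrite big_nat_recr//= IH exprS natrD -muln2 natrM invfM.
have : (2 : R) ^+ n != 0 by rewrite expf_neq0.
by move=> h; field.
Qed.

Lemma prefix_val_growth xi n k :
  ((prefix_val xi n) * 2 ^ k <= prefix_val xi (n + k) < (prefix_val xi n).+1 * 2 ^ k)%N.
Proof.
elim: k => [|k IH]; first by rewrite addn0 !muln1; lia.
by rewrite addnS /= expnS; case: (xi _); lia.
Qed.

(** The upper bound is attained by expansions that end in ones, so the
    interval has to be closed on the right. *)
Lemma binary_sum_itv (R : realType) xi n :
  (prefix_val xi n)%:R <= binary_sum R xi * 2 ^+ n <= (prefix_val xi n)%:R + 1.
Proof.
pose s N : R := \sum_(1 <= i < N) ((xi i)%:R / 2 ^+ i).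
have s_nd : nondecreasing_seq s.
  apply/nondecreasing_seqP => -[|N]; first by rewrite /s !big_geq.
  by rewrite /s [leRHS]big_nat_recr//= lerDl mulr_ge0// invr_ge0 exprn_ge0.
have s_itv N : (n < N)%N ->
    (prefix_val xi n)%:R / 2 ^+ n <= s N <= (prefix_val xi n).+1%:R / 2 ^+ n.
  case: N => // N; rewrite ltnS => nN; rewrite /s partial_binary_sum.
  rewrite -(subnKC nN); set k := (N - n)%N.
  have rescale m : m%:R / 2 ^+ n = (m * 2 ^ k)%:R / 2 ^+ (n + k) :> R.
    by rewrite natrM natrX exprD; field; rewrite !expf_neq0.
  have /andP[lo /ltnW hi] := prefix_val_growth xi n k.
  by rewrite !rescale !ler_pM2r ?invr_gt0 ?exprn_gt0// !ler_nat lo hi.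
have s_cvg : cvgn s.
  apply: nondecreasing_is_cvgn => //; exists ((prefix_val xi n).+1%:R / 2 ^+ n).
  move=> _ [N _ <-].
  apply: (le_trans (s_nd _ (maxn N n.+1) (leq_maxl _ _))).
  by have /andP[] := s_itv (maxn N n.+1) (leq_maxr _ _).
have -> : binary_sum R xi = limn s by [].
apply/andP; split.
- rewrite -ler_pdivrMr ?exprn_gt0//; apply: limr_ge => //.
  near=> N; have /s_itv/andP[] // : (n < N)%N.
  by near: N; exact: nbhs_infty_gt.
- rewrite natr1 -ler_pdivlMr ?exprn_gt0//; apply: limr_le => //.
  near=> N; have /s_itv/andP[] // : (n < N)%N.
  by near: N; exact: nbhs_infty_gt.
Unshelve. all: by end_near.
Qed.

(** Bits of [u] in the unit interval, for the expansion that does not end in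
    ones. *)
Definition digit (R : realType) (u : R) (j : nat) : bool :=
  odd (Num.truncn (u * 2 ^+ j)).

Lemma prefix_val_digit (R : realType) (u : R) n :
  0 <= u < 1 -> prefix_val (digit u) n = Num.truncn (u * 2 ^+ n).
Proof.
move=> /andP[u0 u1]; elim: n => [|n IH] /=.
  by rewrite expr0 mulr1; apply/esym/truncn_def; rewrite u0.
have pos m : 0 <= u * 2 ^+ m by rewrite mulr_ge0// exprn_ge0.
have /andP[lo hi] := truncn_itv (pos n).
rewrite IH /digit; set t := Num.truncn (u * 2 ^+ n) in IH lo hi *.
have dbl : u * 2 ^+ n.+1 = u * 2 ^+ n * 2 by rewrite exprSr mulrA.
have [h|h] := ltP (u * 2 ^+ n * 2) (t.*2.+1)%:R.
- have -> : Num.truncn (u * 2 ^+ n.+1) = t.*2.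
    apply: truncn_def; rewrite dbl h andbT -muln2 natrM.
    by rewrite ler_pM2r.
  by rewrite odd_double addn0.
- have -> : Num.truncn (u * 2 ^+ n.+1) = t.*2.+1.
    apply: truncn_def; rewrite dbl h /= (_ : t.*2.+2 = t.+1 * 2)%N; last lia.
    by rewrite natrM ltr_pM2r.
  by rewrite /= odd_double addn1.
Qed.

(** The digits of a uniformly distributed point are fair bits: each prefix of
    length [n] has probability [2 ^- n]. *)
Lemma prefix_val_digitP (R : realType) (u : R) n k : (k < 2 ^ n)%N ->
  (0 <= u < 1 /\ prefix_val (digit u) n = k) <-> k%:R / 2 ^+ n <= u < k.+1%:R / 2 ^+ n.
Proof.
move=> kn; rewrite ler_pdivrMr ?exprn_gt0// ltr_pdivlMr ?exprn_gt0//; split.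
  move=> [u01]; rewrite prefix_val_digit// => <-; apply: truncn_itv.
  by case/andP: u01 => u0 _; rewrite mulr_ge0// exprn_ge0.
move=> uk; have u01 : 0 <= u < 1.
  case/andP: uk => ku uk; apply/andP; split.
    by rewrite -(pmulr_lge0 _ (exprn_gt0 n (ltr0n R 2)))// (le_trans _ ku).
  rewrite -(ltr_pM2r (exprn_gt0 n (ltr0n R 2))) mul1r (lt_le_trans uk)//.
  by rewrite -natrX ler_nat.
by split=> //; rewrite prefix_val_digit//; exact: truncn_def.
Qed.

(** * Sets coded by repeated digits, and their natural mass *)

Lemma le_diameter (R : realType) (A : set R) (d : R) x y :
  (diameter A <= d%:E)%E -> A x -> A y -> `|x - y| <= d.
Proof.
move=> dA Ax Ay; rewrite -lee_fin (le_trans _ dA)// /diameter le_max.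
by apply/orP; right; apply: ereal_sup_ubound; exists (x, y).
Qed.

Lemma diameter_le (R : realType) (A : set R) (d : R) : 0 <= d ->
  (forall x y, A x -> A y -> `|x - y| <= d) -> (diameter A <= d%:E)%E.
Proof.
move=> d0 dA; rewrite /diameter ge_max lee_fin d0 /=.
by apply: ge_ereal_sup => _ [[x y] [Ax Ay] <-]; rewrite lee_fin dA.
Qed.

Lemma diameter_ge0 (R : realType) (A : set R) : (0 <= diameter A)%E.
Proof. by rewrite /diameter le_max lexx. Qed.

(** What the arguments use of the number [phi n] of free choices among the
    first [n] digits. Since [phi 1] is 1, positive positions have positive
    counts, so that a coded number only depends on the bits with positive
    index, which are those that [prefix_val] sees. *)
Definition unit_step (phi : nat -> nat) : Prop :=
  [/\ phi 0 = 0, phi 1 = 1 & forall n, phi n <= phi n.+1 <= (phi n).+1]%N.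

Section UnitStep.
Variables (phi : nat -> nat) (phiP : unit_step phi).

Lemma unit_step_homo m n : (m <= n)%N -> (phi m <= phi n)%N.
Proof.
case: phiP => _ _ st; elim: n => [|n IH]; first by case: m.
rewrite leq_eqVlt => /orP[/eqP->//|]; rewrite ltnS => /IH.
by have := st n; lia.
Qed.

Lemma unit_step_le n : (phi n <= n)%N.
Proof. by case: phiP => p0 _ st; elim: n => [|n IH]; [lia|have := st n; lia]. Qed.

Lemma unit_step_gt0 n : (0 < n)%N -> (0 < phi n)%N.
Proof. by case: phiP => _ p1 _ /unit_step_homo; rewrite p1. Qed.

Lemma unit_step_onto n j : (1 <= j <= phi n)%N ->
  exists2 i, (1 <= i <= n)%N & phi i = j.
Proof.
case: phiP => p0 _ st; elim: n => [|n IH]; first by rewrite p0; lia.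
move=> /andP[j1]; rewrite leq_eqVlt => /orP[/eqP->|jn]; first by exists n.+1 => //; lia.
have [|i i1 <-] := IH; first by have := st n; lia.
by exists i => //; lia.
Qed.

(** The first [n] repeated digits and the first [phi n] bits determine each
    other, because [phi] maps [1, ..., n] onto [1, ..., phi n]. *)
Lemma eq_prefix_val_comp (z z' : nat -> bool) n :
  prefix_val (z \o phi) n = prefix_val (z' \o phi) n <->
  prefix_val z (phi n) = prefix_val z' (phi n).
Proof.
rewrite !eq_prefix_val; split=> e.
- by move=> j /unit_step_onto[i i1 <-]; exact: (e i).
- move=> j j1 /=; apply: e; apply/andP; split.
    by apply: unit_step_gt0; lia.
  by apply: unit_step_homo; lia.
Qed.

End UnitStep.

Definition coded (R : realType) (phi : nat -> nat) (z : nat -> bool) : R :=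
  binary_sum R (z \o phi).
Arguments coded : clear implicits.

Lemma coded_itv (R : realType) (phi : nat -> nat) (z : nat -> bool) n :
  (prefix_val (z \o phi) n)%:R <= coded R phi z * 2 ^+ n
    <= (prefix_val (z \o phi) n)%:R + 1.
Proof. exact: binary_sum_itv. Qed.

(** Both points lie in the same closed dyadic interval of length [2 ^- n]. *)
Lemma coded_near (R : realType) (phi : nat -> nat) : unit_step phi ->
  forall (z z' : nat -> bool) n, prefix_val z (phi n) = prefix_val z' (phi n) ->
  `|coded R phi z - coded R phi z'| <= 2 ^- n.
Proof.
move=> phiP z z' n /(iffRL (eq_prefix_val_comp phiP z z' n)) e.
rewrite -(ler_pM2r (exprn_gt0 n (ltr0n R 2)))mulVf ?expf_neq0//.
rewrite -[X in _ * X <= _]ger0_norm ?exprn_ge0// -normrM mulrBl.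
have := coded_itv R phi z n; have := coded_itv R phi z' n; rewrite e ler_norml.
by move: (coded _ _ _ * _) (coded _ _ _ * _) => x y; lra.
Qed.

(** Image of Lebesgue outer measure on the unit interval under the coding of
    points by their digits. As [lebesgue_measure] is defined here on every
    set, as an outer measure, the image applies to the arbitrary members of a
    cover. *)
Definition code_mass (R : realType) (phi : nat -> nat) (A : set R) : \bar R :=
  lebesgue_measure [set u : R | 0 <= u < 1 /\ A (coded R phi (digit u))].

Section CodeMass.
Variables (R : realType) (phi : nat -> nat) (phiP : unit_step phi).
Local Notation mass := (@code_mass R phi).

Lemma lebesgue_outer_subset (A B : set R) : A `<=` B ->
  (lebesgue_measure A <= lebesgue_measure B)%E.
Proof. exact: (@le_outer_measure _ _ ((wlength idfun)^*)%mu). Qed.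

Lemma lebesgue_outer_bigcup (F : nat -> set R) :
  (lebesgue_measure (\bigcup_i F i) <= \sum_(0 <= i <oo) lebesgue_measure (F i))%E.
Proof. exact: (outer_measure_sigma_subadditive ((wlength idfun)^*)%mu). Qed.

Lemma code_mass_ge0 A : (0 <= mass A)%E.
Proof. exact: (@outer_measure_ge0 _ _ ((wlength idfun)^*)%mu). Qed.

Lemma code_mass0 : mass set0 = 0%E.
Proof.
rewrite /code_mass -[RHS](outer_measure0 ((wlength idfun)^*)%mu).
by congr (lebesgue_measure _); apply/seteqP; split=> // u [].
Qed.

Lemma code_mass_bigcup A (F : nat -> set R) : A `<=` \bigcup_i F i ->
  (mass A <= \sum_(0 <= i <oo) mass (F i))%E.
Proof.
move=> AF; apply: le_trans (lebesgue_outer_bigcup _).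
apply: lebesgue_outer_subset => u [u01 /AF[i _ Fi]].
by exists i.
Qed.

Lemma code_mass_esum A (D : set nat) (U : nat -> set R) :
  A `<=` \bigcup_(i in D) U i -> (mass A <= \esum_(i in D) mass (U i))%E.
Proof.
move=> AU; pose V i := if i \in D then U i else set0.
apply: (@le_trans _ _ (\sum_(0 <= i <oo) mass (V i))%E).
  apply: code_mass_bigcup => x /AU[i Di Uix]; exists i => //.
  by rewrite /V mem_set.
rewrite nneseries_esumT; last by move=> i; exact: code_mass_ge0.
rewrite [leRHS]esum_mkcond le_esum// => i _; rewrite /V.
by case: ifP => //; rewrite code_mass0.
Qed.

Lemma lebesgue_unit : lebesgue_measure [set u : R | 0 <= u < 1] = 1%E.
Proof.
rewrite (_ : [set u | _] = `[0, 1[%classic).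
  by rewrite lebesgue_measure_itv/= lte_fin ltr01 -EFinB subr0.
by apply/seteqP; split=> u /=; rewrite in_itv.
Qed.

Lemma lebesgue_cylinder n k : (k < 2 ^ n)%N ->
  lebesgue_measure [set u : R | 0 <= u < 1 /\ prefix_val (digit u) n = k] = (2 ^- n)%:E.
Proof.
move=> kn; rewrite (_ : [set u | _] = `[k%:R / 2 ^+ n, k.+1%:R / 2 ^+ n[%classic).
  rewrite lebesgue_measure_itv/= lte_fin ltr_pM2r ?invr_gt0 ?exprn_gt0//.
  by rewrite ltr_nat leqnn -EFinB -mulrBl -natr1 addrAC subrr add0r mul1r.
by apply/seteqP; split=> u /=; rewrite in_itv/= => /(prefix_val_digitP _ kn).
Qed.

Lemma code_mass_le1 A : (mass A <= 1)%E.
Proof. by rewrite -lebesgue_unit; apply: lebesgue_outer_subset => u []. Qed.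

Lemma code_mass_range A : range (coded R phi) `<=` A -> mass A = 1%E.
Proof.
move=> XA; rewrite -lebesgue_unit; congr lebesgue_measure.
by apply/seteqP; split=> [u []//|u u01]; split=> //; apply: XA; exists (digit u).
Qed.

(** Fixing [n] digits of the coded point fixes [phi n] bits of [u]. *)
Lemma lebesgue_prefix_fibre n k :
  (lebesgue_measure [set u : R | (0 <= u < 1)%R /\ prefix_val (digit u \o phi) n = k] <=
   (2 ^- phi n)%:E)%E.
Proof.
set F := [set u | _]; have [[u [u01 uk]]|F0] := pselect (F !=set0); last first.
  rewrite (_ : F = set0); last by apply/seteqP; split=> // u Fu; apply: F0; exists u.
  by rewrite measure0 lee_fin invr_ge0 exprn_ge0.
rewrite -(lebesgue_cylinder (prefix_val_lt (digit u) (phi n))).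
apply: lebesgue_outer_subset => v [v01 vk]; split=> //.
by apply/(eq_prefix_val_comp phiP); rewrite uk vk.
Qed.

(** The points of a set of diameter at most [2 ^- n] have prefixes that differ
    from any one of them by at most 2, which leaves five values. *)
Lemma code_mass_small A n : (diameter A <= (2 ^- n)%:E)%E ->
  (mass A <= (5 / 2 ^+ phi n)%:E)%E.
Proof.
move=> dA; rewrite /code_mass; set F := [set u | _].
have [[u0 [u01 Au0]]|F0] := pselect (F !=set0); last first.
  rewrite (_ : F = set0); last by apply/seteqP; split=> // u Fu; apply: F0; exists u.
  by rewrite measure0 lee_fin divr_ge0 ?exprn_ge0.
pose k0 := prefix_val (digit u0 \o phi) n.
(* A prefix [k] within 2 of [k0] is found at [j = k + 2 - k0 < 5], and no
   subtraction is truncated. *)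
pose C (j : nat) := [set u : R | 0 <= u < 1 /\
  prefix_val (digit u \o phi) n = (k0 + j - 2)%N].
have FC : F `<=` \big[setU/set0]_(j < 5) C j.
  move=> u [u1 Au]; rewrite -bigcup_mkord /C /=.
  have near : `|coded R phi (digit u) * 2 ^+ n - coded R phi (digit u0) * 2 ^+ n| <= 1.
    rewrite -mulrBl normrM [X in _ * X]ger0_norm ?exprn_ge0//.
    by rewrite -ler_pdivlMr ?exprn_gt0// mul1r (le_diameter dA).
  set k := prefix_val (digit u \o phi) n.
  have [h1 h2] : (k <= k0 + 2)%N /\ (k0 <= k + 2)%N.
    rewrite -!(ler_nat R) !natrD.
    have := coded_itv R phi (digit u) n; have := coded_itv R phi (digit u0) n.
    move: near; rewrite ler_norml -/k -/k0.
    by move: (coded _ _ _ * _) (coded _ _ _ * _) => x y; lra.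
  by exists (k + 2 - k0)%N => /=; [lia|split=> //; rewrite -/k; lia].
apply: (le_trans (lebesgue_outer_subset FC)).
apply: (le_trans (outer_measure_subadditive ((wlength idfun)^*)%mu _ _)).
have -> : (5 / 2 ^+ phi n)%:E = (\sum_(j < 5) (2 ^- phi n)%:E)%E :> \bar R.
  by rewrite sumEFin sumr_const card_ord mulr_natl.
by apply: lee_sum => j _; exact: lebesgue_prefix_fibre.
Qed.

End CodeMass.

(** * Dyadic scales, exponentials and sums *)

Lemma dyadic_scale (R : realType) (d : R) : 0 < d <= 1 ->
  exists n : nat, 2 ^- n.+1 < d <= 2 ^- n.
Proof.
move=> /andP[d0 d1]; have di1 : 1 <= d^-1 by rewrite invf_ge1.
have t0 : (0 < Num.truncn d^-1)%N by rewrite truncn_gt0.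
have /andP[lo hi] := truncn_itv (le_trans ler01 di1).
have /andP[lo2 hi2] := trunc_log_bounds (ltnSn 1) t0.
exists (trunc_log 2 (Num.truncn d^-1)).
apply/andP; split.
- rewrite -[ltRHS]invrK ltf_pV2 ?posrE ?invr_gt0 ?exprn_gt0// (lt_le_trans hi)//.
  by rewrite -natrX ler_nat.
- rewrite -[leLHS]invrK lef_pV2 ?posrE ?invr_gt0 ?exprn_gt0//.
  by rewrite (le_trans _ lo)// -natrX ler_nat.
Qed.

Lemma dyadic_le (R : realType) (m n : nat) :
  ((2 ^- n : R) <= 2 ^- m) = (m <= n)%N.
Proof. by rewrite lef_pV2 ?posrE ?exprn_gt0// ler_eXn2l// ltr1n. Qed.

Lemma dyadic_lt (R : realType) (m n : nat) :
  ((2 ^- n : R) < 2 ^- m) = (m < n)%N.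
Proof. by rewrite ltf_pV2 ?posrE ?exprn_gt0// ltr_eXn2l// ltr1n. Qed.

Lemma exists_dyadic_le (R : realType) (e : R) : 0 < e -> exists n : nat, 2 ^- n <= e.
Proof.
move=> e0; have m0 : 0 < Num.min e 1 <= 1 by rewrite lt_min e0 ltr01 ge_min lexx orbT.
have [n /andP[/ltW h _]] := dyadic_scale m0; exists n.+1.
by rewrite (le_trans h)// ge_min lexx.
Qed.

Lemma dyadic_powR (R : realType) (n : nat) (s : R) : (2 ^- n) `^ s = 2 `^ (- (n%:R * s)).
Proof. by rewrite -mulNr powRrM powRN powR_mulrn. Qed.

(** Exponential growth, from the inequality [1 + x <= expR x]. *)
Lemma powR2_unbounded (R : realType) (c K : R) : 0 < c ->
  exists N : nat, forall n : nat, (N <= n)%N -> K <= 2 `^ (c * n%:R).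
Proof.
move=> c0; have l0 : 0 < ln (2 : R) by rewrite ln_gt0// ltr1n.
exists (Num.truncn (K / (c * ln 2))).+1 => n Nn.
rewrite /powR gt_eqF//; apply: le_trans (expR_ge1Dx _).
rewrite mulrAC (le_trans (_ : K <= c * ln 2 * n%:R))//; last by rewrite lerDr.
rewrite mulrC -ler_pdivrMr ?mulr_gt0//.
by apply: (le_trans (ltW (truncnS_gt _))); rewrite ler_nat.
Qed.

Lemma le_diameter_powR (R : realType) (A : set R) (d s : R) : 0 <= s ->
  (diameter A <= d%:E)%E -> (diameter A `^ s <= (d `^ s)%:E)%E.
Proof.
move=> s0 Ad; rewrite -poweR_EFin gt0_ler_poweR// in_itv/= leey ?diameter_ge0//.
by rewrite (le_trans (diameter_ge0 A) Ad).
Qed.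

Lemma esum_ordinal (R : realType) M (f : nat -> \bar R) : (forall i, 0 <= f i)%E ->
  (\esum_(i in `I_M) f i = \sum_(i < M) f i)%E.
Proof. by move=> f0; rewrite esum_fset//= fsbig_ord. Qed.

Lemma esum_ordinal_le (R : realType) M (f : nat -> \bar R) (c : R) :
  (forall i, 0 <= f i)%E -> (forall i, (i < M)%N -> (f i <= c%:E)%E) ->
  (\esum_(i in `I_M) f i <= (M%:R * c)%:E)%E.
Proof.
move=> f0 fc; rewrite esum_ordinal//.
have -> : (M%:R * c)%:E = (\sum_(j < M) c%:E)%E :> \bar R.
  by rewrite sumEFin sumr_const card_ord mulr_natl.
by apply: lee_sum => j _; exact: fc.
Qed.

Lemma esumZl (R : realType) (D : set nat) (f : nat -> \bar R) (c : R) :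
  0 <= c -> (forall i, 0 <= f i)%E ->
  (\esum_(i in D) (c%:E * f i) = c%:E * \esum_(i in D) f i)%E.
Proof.
move=> c0 f0; have if0 i : (0 <= if i \in D then f i else 0)%E by case: ifP.
transitivity (\sum_(0 <= i <oo) (c%:E * if i \in D then f i else 0))%E; last first.
  by rewrite nneseriesZl// nneseries_esumT// -esum_mkcond.
rewrite nneseries_esumT => [|i]; last by rewrite mule_ge0.
by rewrite [LHS]esum_mkcond; apply: eq_esum => i _; case: ifP; rewrite ?mule0.
Qed.

(** * Hausdorff dimension *)

(** One covering set for each value of the first [phi n] bits. *)
Lemma coded_cover (R : realType) (phi : nat -> nat) n : unit_step phi ->
  exists U : nat -> set R, range (coded R phi) `<=` \bigcup_(i < 2 ^ phi n) U i /\
    forall i, (i < 2 ^ phi n)%N -> (diameter (U i) <= (2 ^- n)%:E)%E.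
Proof.
move=> phiP; exists (fun i => coded R phi @` [set z | prefix_val z (phi n) = i]); split.
  by move=> _ [z _ <-]; exists (prefix_val z (phi n)) => /=; [exact: prefix_val_lt|exists z].
move=> i _; apply: diameter_le; first by rewrite invr_ge0 exprn_ge0.
by move=> _ _ [z zi <-] [z' zi' <-]; apply: coded_near => //; rewrite zi zi'.
Qed.

Lemma hausdorff_premeasure_ge0 (R : realType) (s : R) F d :
  (0 <= hausdorff_premeasure s F d)%E.
Proof.
apply: le_ereal_inf_tmp => _ [D [U [_ _ ->]]].
by apply: esum_ge0 => i _; exact: poweR_ge0.
Qed.

(** The premeasure increases as the mesh decreases, so that its limit at 0 is
    a supremum. *)
Lemma hausdorff_measureE (R : realType) (s : R) F :
  hausdorff_measure s F =
  ereal_sup (hausdorff_premeasure s F @` [set d | 0 < d]).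
Proof.
rewrite (_ : [set d | 0 < d] = [set` `]0, +oo[]); last first.
  by apply/seteqP; split=> x; rewrite /= in_itv/= andbT.
apply/cvg_lim => //; apply: nonincreasing_at_right_cvge => // x y _ _ xy.
apply: ereal_inf_le_tmp => _ [D [U [FU Ud ->]]]; exists D, U; split=> // i Di.
by rewrite (le_trans (Ud i Di))// lee_fin.
Qed.

Section HausdorffDimension.
Variables (R : realType) (phi : nat -> nat) (phiP : unit_step phi).
Local Notation X := (range (coded R phi)).

(** At the scales where [phi n <= t * n], the [2 ^ phi n] pieces of size
    [2 ^- n] contribute at most [2 ^ (- (s - t) * n)]. *)
Lemma hausdorff_measure_eq0 (s t : R) : 0 <= s -> t < s ->
  (forall N, exists2 n, (N <= n)%N & (phi n)%:R <= t * n%:R) ->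
  hausdorff_measure s X = 0%E.
Proof.
move=> s0 ts freq; rewrite hausdorff_measureE.
apply/eqP; rewrite eq_le; apply/andP; split; last first.
  apply: (le_trans (hausdorff_premeasure_ge0 s X 1)).
  by apply: ereal_sup_ubound; exists 1 => /=.
apply: ge_ereal_sup => _ [d /= d0 <-]; apply/lee_addgt0Pr => e e0; rewrite add0e.
have [m md] := exists_dyadic_le d0.
have st : 0 < s - t by rewrite subr_gt0.
have [N HN] := powR2_unbounded e^-1 st.
have [n nN phin] := freq (maxn m N).
have [U [XU Ud]] := coded_cover R n phiP.
apply: (le_trans (ereal_inf_lbound _)).
  exists `I_(2 ^ phi n), U; split=> // i /= iM.
  by rewrite (le_trans (Ud i iM))// lee_fin (le_trans _ md)// dyadic_le; lia.
apply: (le_trans (esum_ordinal_le (c := (2 ^- n) `^ s) _ _)).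
- by move=> i; exact: poweR_ge0.
- by move=> i iM; apply: le_diameter_powR => //; exact: Ud.
rewrite lee_fin dyadic_powR natrX -powR_mulrn// -powRD ?pnatr_eq0 ?implybT//.
apply: (le_trans (_ : _ <= 2 `^ (- ((s - t) * n%:R)))).
  by apply: ler_powR; [rewrite ler1n|rewrite mulrBl; lra].
rewrite powRN -[leRHS]invrK lef_pV2 ?posrE ?invr_gt0 ?powR_gt0//.
apply: HN; lia.

Qed.

(** Compare the diameter with a power of 2. Sets of diameter 0 are treated
    apart: if [s] is positive they have mass 0, and if [s] is 0 the power is
    1, which bounds all masses. *)
Lemma code_mass_le_powR (s t : R) : 0 <= s < t ->
  (exists N, forall n, (N <= n)%N -> t * n%:R <= (phi n)%:R) ->
  exists C d0 : R, [/\ 0 < C, 0 < d0 & forall A : set R, (diameter A <= d0%:E)%E ->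
    (code_mass phi A <= C%:E * diameter A `^ s)%E].
Proof.
move=> /andP[s0 st] [N HN].
have mass_le (A : set R) n : (N <= n)%N -> (diameter A <= (2 ^- n)%:E)%E ->
    (code_mass phi A <= (5 * 2 `^ (- (t * n%:R)))%:E)%E.
  move=> Nn /(code_mass_small phiP) /le_trans; apply.
  rewrite lee_fin ler_pM2l// powRN lef_pV2 ?posrE ?powR_gt0 ?exprn_gt0//.
  by rewrite -powR_mulrn//; apply: ler_powR; rewrite ?ler1n//; exact: HN.
have [->|sn0] := eqVneq s 0.
  exists 1, 1; split=> // A _; rewrite poweRe0 mule1; exact: code_mass_le1.
have s_gt0 : 0 < s by rewrite lt_neqAle eq_sym sn0.
exists (5 * 2 `^ s), (2 ^- N); split; rewrite ?mulr_gt0 ?powR_gt0 ?invr_gt0 ?exprn_gt0//.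
move=> A AN.
have : diameter A \is a fin_num.
  by rewrite ge0_fin_numE ?diameter_ge0// (le_lt_trans AN)// ltry.
move=> Afin; move: (diameter_ge0 A) AN (mass_le A); rewrite -(fineK Afin).
set d := fine (diameter A) => {Afin}; rewrite !lee_fin poweR_EFin -EFinM => d0 dN {}mass_le.
have [dz|dn0] := eqVneq d 0.
  rewrite dz powR0 ?mulr0//; apply/lee_addgt0Pr => e e0; rewrite add0e.
  have [M HM] := powR2_unbounded (5 / e) (le_lt_trans s0 st).
  apply: (le_trans (mass_le (maxn M N) _ _)); first by lia.
    by rewrite lee_fin dz invr_ge0 exprn_ge0.
  rewrite lee_fin powRN ler_pdivrMr ?powR_gt0// mulrC -ler_pdivrMr//.
  by apply: HM; lia.
have d_gt0 : 0 < d by rewrite lt_neqAle eq_sym dn0.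
have d1 : d <= 1 by rewrite (le_trans dN)// invf_le1 ?exprn_gt0// exprn_ege1// ler1n.
have [|n /andP[nd dn]] := @dyadic_scale R d; first by rewrite d_gt0.
have Nn : (N <= n)%N by rewrite -ltnS -(dyadic_lt R) (lt_le_trans nd).
apply: (le_trans (mass_le n Nn _)); first by rewrite lee_fin.
rewrite lee_fin -mulrA ler_pM2l//.
apply: (le_trans (_ : _ <= 2 `^ s * (2 ^- n.+1) `^ s)).
  rewrite dyadic_powR -powRD ?pnatr_eq0 ?implybT//; apply: ler_powR; first by rewrite ler1n.
  rewrite -natr1 mulrDl mul1r.
  have : s * n%:R <= t * n%:R by rewrite ler_wpM2r// ltW.
  by rewrite (mulrC _ s); lra.
rewrite ler_pM2l ?powR_gt0//; apply: ge0_ler_powR => //.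
- by rewrite nnegrE invr_ge0 exprn_ge0.
- exact: ltW.
Qed.

(** Mass distribution principle: summing [code_mass_le_powR] over a cover
    bounds the total mass 1 by a multiple of the premeasure. *)
Lemma hausdorff_measure_neq0 (s t : R) : 0 <= s < t ->
  (exists N, forall n, (N <= n)%N -> t * n%:R <= (phi n)%:R) ->
  hausdorff_measure s X <> 0%E.
Proof.
move=> st ev H0; have [C [d0 [C0 d00 mass_le]]] := code_mass_le_powR st ev.
have H0' : (hausdorff_premeasure s X d0 <= 0)%E.
  by rewrite -H0 hausdorff_measureE; apply: ereal_sup_ubound; exists d0.
suff : (C^-1%:E <= hausdorff_premeasure s X d0)%E.
  by move=> /le_trans/(_ H0'); rewrite lee_fin invr_le0 leNgt C0.
apply: le_ereal_inf_tmp => _ [D [U [XU Ud ->]]].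
rewrite -[leLHS]mule1 lee_pdivrMl//.
apply: (@le_trans _ _ (code_mass phi X)).
  by rewrite (code_mass_range (phi := phi)).
apply: (le_trans (code_mass_esum _ XU)); rewrite -(esumZl _ (ltW C0)); last first.
  by move=> i; exact: poweR_ge0.
by apply: le_esum => i Di; apply: mass_le; exact: Ud.
Qed.

End HausdorffDimension.

(** * Box dimensions and their modified versions *)

Lemma at_right0P (R : realType) (V : set R) :
  (0:R)^'+ V <-> exists2 e, 0 < e & forall x, 0 < x < e -> V x.
Proof.
split=> [[e /= e0 eV]|[e e0 eV]].
  exists e => // x /andP[x0 xe]; apply: eV => //=.
  by rewrite sub0r normrN gtr0_norm.
exists e => //= x /=; rewrite sub0r normrN => xe x0; apply: eV.
by rewrite x0 /= -(gtr0_norm x0).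
Qed.

Lemma limf_esup_le_of_near (R : realType) (f : R -> \bar R) (l : \bar R) (e : R) :
  0 < e -> (forall x, 0 < x < e -> (f x <= l)%E) ->
  (limf_esup f (0:R)^'+ <= l)%E.
Proof.
move=> e0 fl; rewrite limf_esupE; apply: (@le_trans _ _ (ereal_sup (f @` [set x | 0 < x < e]))).
  apply: ereal_inf_lbound; exists [set x | 0 < x < e] => //.
  by apply/at_right0P; exists e.
by apply: ge_ereal_sup => _ [x xe <-]; exact: fl.
Qed.

Lemma limf_einf_ge_of_near (R : realType) (f : R -> \bar R) (l : \bar R) (e : R) :
  0 < e -> (forall x, 0 < x < e -> (l <= f x)%E) ->
  (l <= limf_einf f (0:R)^'+)%E.
Proof.
move=> e0 fl; rewrite limf_einfE; apply: (@le_trans _ _ (ereal_inf (f @` [set x | 0 < x < e]))).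
  by apply: le_ereal_inf_tmp => _ [x xe <-]; exact: fl.
apply: ereal_sup_ubound; exists [set x | 0 < x < e] => //.
by apply/at_right0P; exists e.
Qed.

(** Lower bounds for an upper limit, and upper bounds for a lower limit, need
    to be checked at the dyadic scales only. *)
Lemma limf_esup_ge_of_dyadic (R : realType) (f : R -> \bar R) (l : \bar R) :
  (forall N, exists2 n, (N <= n)%N & (l <= f (2 ^- n)%R)%E) ->
  (l <= limf_esup f (0:R)^'+)%E.
Proof.
move=> fl; rewrite limf_esupE; apply: le_ereal_inf_tmp => _ [V /at_right0P[e e0 eV] <-].
have [N Ne] := exists_dyadic_le e0; have [n nN ln] := fl N.+1.
apply: (le_trans ln); apply: ereal_sup_ubound; exists (2 ^- n) => //; apply: eV.
by rewrite invr_gt0 exprn_gt0//= (lt_le_trans _ Ne)// dyadic_lt.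
Qed.

Lemma limf_einf_le_of_dyadic (R : realType) (f : R -> \bar R) (l : \bar R) :
  (forall N, exists2 n, (N <= n)%N & (f (2 ^- n)%R <= l)%E) ->
  (limf_einf f (0:R)^'+ <= l)%E.
Proof.
move=> fl; rewrite limf_einfE; apply: ge_ereal_sup => _ [V /at_right0P[e e0 eV] <-].
have [N Ne] := exists_dyadic_le e0; have [n nN ln] := fl N.+1.
apply: le_trans ln; apply: ereal_inf_lbound; exists (2 ^- n) => //; apply: eV.
by rewrite invr_gt0 exprn_gt0//= (lt_le_trans _ Ne)// dyadic_lt.
Qed.

Lemma covering_number_le (R : realType) (F : set R) (e : R) (M : nat)
    (U : nat -> set R) : F `<=` \bigcup_(i < M) U i ->
  (forall i, (i < M)%N -> (diameter (U i) <= e%:E)%E) ->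
  covering_number F e <= M%:R.
Proof.
move=> FU Ue; apply: ge_inf; first by exists 0 => _ [n _ <-].
by exists M => //; exists U.
Qed.

Lemma bounded_finite_cover (R : realType) (F : set R) (e : R) : 0 < e ->
  bounded_set F -> exists M (U : nat -> set R), F `<=` \bigcup_(i < M) U i /\
    forall i, (i < M)%N -> (diameter (U i) <= e%:E)%E.
Proof.
move=> e0 [B0 [_ /(_ (Num.max B0 0 + 1))]].
rewrite (le_lt_trans (_ : B0 <= Num.max B0 0)) ?ltrDl ?le_max ?lexx// => /(_ isT).
set B := Num.max B0 0 + 1 => FB.
exists (Num.truncn ((B + B) / e)).+1, (fun i => [set x | i%:R * e <= x + B <= i.+1%:R * e]).
split.
- move=> x Fx; have := FB x Fx; rewrite /= ler_norml => /andP[xl xu].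
  have xB : 0 <= (x + B) / e by apply: divr_ge0; lra.
  have /andP[lo hi] := truncn_itv xB.
  exists (Num.truncn ((x + B) / e)) => /=; last first.
    by rewrite -ler_pdivlMr// lo -ler_pdivrMr// ltW.
  rewrite ltnS; apply: le_truncn; rewrite ler_pM2r ?invr_gt0//; lra.
- move=> i _; apply: diameter_le; first exact: ltW.
  move=> x y /= /andP[] + + /andP[]; rewrite -natr1 mulrDl mul1r ler_norml.
  by move: (_ * e) => z; lra.
Qed.

Lemma covering_number_ge (R : realType) (F : set R) (e c : R) : 0 < e ->
  bounded_set F ->
  (forall M (U : nat -> set R), F `<=` \bigcup_(i < M) U i ->
    (forall i, (i < M)%N -> (diameter (U i) <= e%:E)%E) -> c <= M%:R) ->
  c <= covering_number F e.
Proof.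
move=> e0 bF cM; apply: lb_le_inf.
  by have [M [U FU]] := bounded_finite_cover e0 bF; exists M%:R, M => //; exists U.
by move=> _ [M [U [FU Ue]] <-]; exact: cM FU Ue.
Qed.

Lemma ln_le_of (R : realType) (x y : R) : 1 <= y -> x <= y -> ln x <= ln y.
Proof.
move=> y1 xy; have [x0|x0] := leP x 0; first by rewrite (ln0 x0) ln_ge0.
by rewrite ler_ln ?posrE// (lt_le_trans x0).
Qed.

Section BoxDimension.
Variables (R : realType) (phi : nat -> nat) (phiP : unit_step phi).
Local Notation X := (range (coded R phi)).
Local Notation mass := (code_mass phi).

Let ln2_gt0 : 0 < ln (2 : R).
Proof. by rewrite ln_gt0// ltr1n. Qed.

Lemma bounded_coded : bounded_set X.
Proof.
exists 1; split=> // B B1 _ [z _ <-] /=; rewrite (le_trans _ (ltW B1))//.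
have := coded_itv R phi z 0; rewrite /= expr0 mulr1 add0r => /andP[h0 h1].
by rewrite ger0_norm.
Qed.

Lemma coded_nonempty : X !=set0.
Proof. by exists (coded R phi xpredT), xpredT. Qed.

Lemma lnXn2 n : ln (2 ^+ n : R) = n%:R * ln 2.
Proof. by rewrite -powR_mulrn// ln_powR. Qed.

Lemma ln_covering_number_le n e : 2 ^- n <= e ->
  ln (covering_number X e) <= (phi n)%:R * ln 2.
Proof.
move=> ne; have [U [XU Ud]] := coded_cover R n phiP.
rewrite -lnXn2 -natrX; apply: ln_le_of; first by rewrite ler1n expn_gt0.
apply: covering_number_le XU _ => i iM; rewrite (le_trans (Ud i iM))//.
Qed.

(** Each covering set has mass at most [5 / 2 ^ phi n], so the number of sets
    times this is at least the mass of [G]. *)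
Lemma ln_covering_number_ge (G : set R) : bounded_set G -> (0 < mass G)%E ->
  exists c : R, forall n e, 0 < e <= 2 ^- n ->
    c + (phi n)%:R * ln 2 <= ln (covering_number G e).
Proof.
move=> bG G0; have Gfin : mass G \is a fin_num.
  by rewrite ge0_fin_numE ?code_mass_ge0// (le_lt_trans (code_mass_le1 _ _))// ltry.
have c0 : 0 < fine (mass G) / 5 by rewrite divr_gt0// fine_gt0// G0 -ge0_fin_numE ?code_mass_ge0.
exists (ln (fine (mass G) / 5)) => n e /andP[e0 en].
rewrite -lnXn2 -lnM ?posrE ?exprn_gt0//.
have h : fine (mass G) / 5 * 2 ^+ phi n <= covering_number G e.
  apply: covering_number_ge => // M U GU Ud.
  rewrite -ler_pdivlMr ?exprn_gt0// ler_pdivrMr// -mulrA -(mulrC 5).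
  rewrite -lee_fin fineK//; apply: (le_trans (code_mass_esum _ GU)).
  apply: esum_ordinal_le => i; first exact: code_mass_ge0.
  by move=> iM; apply: code_mass_small => //; rewrite (le_trans (Ud i iM)) ?lee_fin.
rewrite ler_ln ?posrE//; first by rewrite mulr_gt0// exprn_gt0.
by rewrite (lt_le_trans _ h)// mulr_gt0// exprn_gt0.
Qed.

(** The form of [dyadic_scale] in which box ratios are estimated. *)
Lemma dyadic_scale_ln (d : R) : 0 < d <= 1 ->
  exists2 n : nat, 2 ^- n.+1 < d <= 2 ^- n & n%:R * ln 2 <= - ln d <= n.+1%:R * ln 2.
Proof.
move=> d01; have /andP[d0 _] := d01; have [n nd] := dyadic_scale d01; exists n => //.
case/andP: nd => nd dn; rewrite -!lnXn2 -lnV ?posrE// !ler_ln ?posrE ?invr_gt0 ?exprn_gt0//.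
rewrite -[X in X <= _ <= _]invrK -[X in _ <= _ <= X]invrK.
by rewrite !lef_pV2 ?posrE ?invr_gt0 ?exprn_gt0// dn ltW.
Qed.

Lemma neg_ln_ge (K d : R) : 0 < d < expR (- K) -> K <= - ln d.
Proof.
move=> /andP[d0 dK]; rewrite lerNr -[leRHS]expRK ler_ln ?posrE ?expR_gt0//.
exact: ltW.
Qed.

Lemma lower_box_dim_le t :
  (forall N, exists2 n, (N <= n)%N & (phi n)%:R <= t * n%:R) ->
  (lower_box_dim X <= t%:E)%E.
Proof.
move=> freq; apply: limf_einf_le_of_dyadic => N.
have [n nN phin] := freq N.+1; exists n; first exact: ltnW.
have n0 : 0 < n%:R * ln 2 :> R by rewrite mulr_gt0// ltr0n; lia.
rewrite /box_ratio lee_fin lnV ?posrE ?exprn_gt0// opprK lnXn2 ler_pdivrMr//.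
rewrite (le_trans (ln_covering_number_le (lexx _)))//.
by rewrite mulrA ler_pM2r.
Qed.

Lemma upper_box_dim_ge (G : set R) t t' : bounded_set G -> (0 < mass G)%E -> t' < t ->
  (forall N, exists2 n, (N <= n)%N & t * n%:R <= (phi n)%:R) ->
  (t'%:E <= upper_box_dim G)%E.
Proof.
move=> bG G0 tt' freq; apply: limf_esup_ge_of_dyadic => N.
have [c Hc] := ln_covering_number_ge bG G0.
pose K := - c / ((t - t') * ln 2).
have [n nN phin] := freq (maxn N (Num.truncn K).+1); exists n; first lia.
have nK : K <= n%:R.
  apply: (le_trans (ltW (truncnS_gt _))); rewrite ler_nat.
  exact: leq_trans (leq_maxr _ _) nN.
have n0 : 0 < n%:R * ln 2 :> R by rewrite mulr_gt0// ltr0n; lia.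
rewrite /box_ratio lee_fin lnV ?posrE ?exprn_gt0// opprK lnXn2 ler_pdivlMr//.
have nn : 0 < (2 ^- n : R) <= 2 ^- n by rewrite invr_gt0 exprn_gt0/=.
apply: le_trans (Hc n _ nn).
have : - c <= n%:R * ((t - t') * ln 2) by rewrite -ler_pdivrMr// mulr_gt0// subr_gt0.
have : t * n%:R * ln 2 <= (phi n)%:R * ln 2 by rewrite ler_pM2r.
nra.
Qed.

Lemma upper_box_dim_le t t' : 0 <= t < t' ->
  (exists N, forall n, (N <= n)%N -> (phi n)%:R <= t * n%:R) ->
  (upper_box_dim X <= t'%:E)%E.
Proof.
(* Passing from [n] to [n.+1] costs [t * ln 2], negligible once
   [- ln d >= K]. *)
move=> /andP[t0 tt'] [N HN]; pose K := t * ln 2 / (t' - t).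
pose e : R := Num.min (2 ^- N.+1) (expR (- K)).
apply: (@limf_esup_le_of_near _ _ _ e).
  by rewrite lt_min expR_gt0 invr_gt0 exprn_gt0.
move=> d /andP[d0]; rewrite lt_min => /andP[dN dK].
have d1 : d < 1 by rewrite (lt_le_trans dN)// invf_le1 ?exprn_gt0// exprn_ege1// ler1n.
have [|n /andP[nd _] /andP[nl _]] := @dyadic_scale_ln d; first by rewrite d0 ltW.
have lK : K <= - ln d by apply: neg_ln_ge; rewrite d0.
have Nn : (N <= n)%N by have := lt_trans nd dN; rewrite dyadic_lt; lia.
have l0 : 0 < - ln d by rewrite oppr_gt0 ln_lt0// d0.
rewrite /box_ratio lee_fin ler_pdivrMr//.
apply: (le_trans (ln_covering_number_le (ltW nd))).
apply: (le_trans (_ : _ <= t * n.+1%:R * ln 2)).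
  by rewrite ler_pM2r// HN//; lia.
have : t * ln 2 <= - ln d * (t' - t) by rewrite -ler_pdivrMr// subr_gt0.
have : t * (n%:R * ln 2) <= t * - ln d by rewrite ler_wpM2l.
rewrite -natr1; nra.
Qed.

Lemma lower_box_dim_ge (G : set R) t t' : bounded_set G -> (0 < mass G)%E ->
  0 <= t -> t' < t ->
  (exists N, forall n, (N <= n)%N -> t * n%:R <= (phi n)%:R) ->
  (t'%:E <= lower_box_dim G)%E.
Proof.
move=> bG G0 t0 tt' [N HN]; have [c Hc] := ln_covering_number_ge bG G0.
(* The constants [t * ln 2] and [c] are negligible once [- ln d >= K]. *)
pose K := (t * ln 2 - c) / (t - t').
pose e : R := Num.min (2 ^- N.+1) (expR (- K)).
apply: (@limf_einf_ge_of_near _ _ _ e).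
  by rewrite lt_min expR_gt0 invr_gt0 exprn_gt0.
move=> d /andP[d0]; rewrite lt_min => /andP[dN dK].
have d1 : d < 1 by rewrite (lt_le_trans dN)// invf_le1 ?exprn_gt0// exprn_ege1// ler1n.
have [|n /andP[nd dn] /andP[_ ln']] := @dyadic_scale_ln d; first by rewrite d0 ltW.
have lK : K <= - ln d by apply: neg_ln_ge; rewrite d0.
have Nn : (N <= n)%N by have := lt_trans nd dN; rewrite dyadic_lt; lia.
have l0 : 0 < - ln d by rewrite oppr_gt0 ln_lt0// d0.
rewrite /box_ratio lee_fin ler_pdivlMr//.
apply: (le_trans _ (Hc n d _)); last by rewrite d0.
have : t * n%:R * ln 2 <= (phi n)%:R * ln 2 by rewrite ler_pM2r// HN.
have : t * ln 2 - c <= - ln d * (t - t') by rewrite -ler_pdivrMr// subr_gt0.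
have : t * - ln d <= t * (n.+1%:R * ln 2) by rewrite ler_wpM2l.
rewrite -natr1; nra.
Qed.

Lemma modified_dim_le (dim : set R -> \bar R) : (modified_dim dim X <= dim X)%E.
Proof.
apply: (@le_trans _ _ (ereal_sup (range (fun _ : nat => dim X)))).
  apply: ereal_inf_lbound; exists (fun _ => X) => //; split.
    by move=> x Xx; exists 0%N.
  by move=> _; split; [exact: coded_nonempty|exact: bounded_coded].
by apply: ge_ereal_sup => _ [i _ <-].
Qed.

Lemma code_mass_gt0_of_cover (G : nat -> set R) : X `<=` \bigcup_i G i ->
  exists i, (0 < mass (G i))%E.
Proof.
move=> XG; apply: contrapT => /forallNP G0.
have : (mass X <= 0)%E.
  apply: (le_trans (code_mass_bigcup phi XG)); rewrite eseries0// => i _ _.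
  apply/eqP; rewrite eq_le code_mass_ge0 andbT leNgt; apply/negP; exact: G0.
by rewrite code_mass_range// leNgt lte01.
Qed.

(** By countable subadditivity every cover has a member of positive mass, so a
    bound on such sets is enough. *)
Lemma modified_dim_ge (dim : set R -> \bar R) (l : \bar R) :
  (forall G, bounded_set G -> (0 < mass G)%E -> (l <= dim G)%E) ->
  (l <= modified_dim dim X)%E.
Proof.
move=> ldim; apply: le_ereal_inf_tmp => _ [G [XG Gb] <-].
have [i Gi] := code_mass_gt0_of_cover XG.
apply: (le_trans (ldim (G i) (Gb i).2 Gi)).
by apply: ereal_sup_ubound; exists i.
Qed.

End BoxDimension.

(** * Packing dimension *)

Lemma closed_ballP (R : realType) (c r : R) : 0 < r ->
  closed_ball c r = [set y | `|c - y| <= r].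
Proof. by move=> r0; rewrite closed_ballE. Qed.

Lemma diameter_closed_ball (R : realType) (c r : R) : 0 < r ->
  diameter (closed_ball c r) = (2 * r)%:E.
Proof.
move=> r0; have B := closed_ballP c r0.
apply/eqP; rewrite eq_le; apply/andP; split.
- apply: diameter_le; first by rewrite mulr_ge0// ltW.
  by move=> x y; rewrite B /= !ler_norml; lra.
- have -> : 2 * r = `|(c + r) - (c - r)| by rewrite ger0_norm; lra.
  rewrite /diameter le_max; apply/orP; right; apply: ereal_sup_ubound.
  by exists (c + r, c - r) => //; split; rewrite /= B /= ler_norml; lra.
Qed.

(** The packing premeasure decreases with the mesh, so that its limit at 0 is
    an infimum. *)
Lemma packing_premeasureE (R : realType) (s : R) F :
  packing_premeasure s F =
  ereal_inf (packing_premeasure_at s F @` [set d | 0 < d]).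
Proof.
rewrite (_ : [set d | 0 < d] = [set` `]0, +oo[]); last first.
  by apply/seteqP; split=> x; rewrite /= in_itv/= andbT.
apply/cvg_lim => //; apply: nondecreasing_at_right_cvge => // x y _ _ xy.
apply: ereal_sup_le => _ [D [c [r [Dcr disj ->]]]]; exists D, c, r; split=> // i Di.
have [Fc /andP[r0 rx]] := Dcr i Di; split=> //.
by rewrite r0 (le_trans rx).
Qed.

Lemma packing_premeasure_ge0 (R : realType) (s : R) F : (0 <= packing_premeasure s F)%E.
Proof.
rewrite packing_premeasureE; apply: le_ereal_inf_tmp => _ [d _ <-].
apply: ereal_sup_ubound; exists set0, (fun=> 0), (fun=> 0).
by split=> //; rewrite esum_set0.
Qed.

Section PackingDimension.
Variables (R : realType) (phi : nat -> nat) (phiP : unit_step phi).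
Local Notation X := (range (coded R phi)).
Local Notation mass := (code_mass phi).

(** Choose [n] with [2 ^- n.+1 < r <= 2 ^- n], and take for [I] the points [u]
    that agree with the centre on its first [n.+1] digits. The length of [I]
    is [2 ^- phi n.+1], hence at least [(r / 2) `^ t]. *)
Lemma cylinder_into_ball (x r t : R) N : 0 <= t -> X x -> 0 < r <= 2 ^- N ->
  (forall n, (N <= n)%N -> (phi n)%:R <= t * n%:R) ->
  exists I : set (measurableTypeR R), [/\ measurable I,
    forall u, I u -> 0 <= u < 1 /\ closed_ball x r (coded R phi (digit u)) &
    ((r `^ t)%:E <= (2 `^ t)%:E * lebesgue_measure I)%E].
Proof.
move=> t0 [z _ <-] /andP[r0 rN] HN.
have N1 : (2 ^- N : R) <= 1 by rewrite invf_le1 ?exprn_gt0// exprn_ege1// ler1n.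
have [|n /andP[nr rn]] := @dyadic_scale R r; first by rewrite r0 (le_trans rN).
have Nn : (N <= n)%N by have := lt_le_trans nr rN; rewrite dyadic_lt.
have km := prefix_val_lt z (phi n.+1).
exists [set u : R | 0 <= u < 1 /\
  prefix_val (digit u) (phi n.+1) = prefix_val z (phi n.+1)].
split.
- set k := prefix_val z _ in km *.
  rewrite (_ : [set u | _] = `[k%:R / 2 ^+ phi n.+1, k.+1%:R / 2 ^+ phi n.+1[%classic).
    exact: measurable_itv.
  by apply/seteqP; split=> u /=; rewrite in_itv/= => /(prefix_val_digitP _ km).
- move=> u [u01 uz]; split=> //; rewrite closed_ballP//=.
  by rewrite (le_trans (coded_near R phiP (esym uz)))// ltW.
- rewrite (lebesgue_cylinder _ km) -EFinM lee_fin.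
  apply: (le_trans (_ : _ <= (2 ^- n) `^ t)).
    by apply: ge0_ler_powR => //; rewrite nnegrE ltW// invr_gt0 exprn_gt0.
  rewrite dyadic_powR -powR_mulrn// -powRN -powRD ?pnatr_eq0 ?implybT//.
  apply: ler_powR; first by rewrite ler1n.
  by have := HN n.+1 (leqW Nn); rewrite -natr1; lra.
Qed.

(** Writing [r `^ s] as [r `^ (s - t) * r `^ t], and bounding the second
    factor by the length of the interval attached to the ball, the sum is
    bounded by the total length of disjoint subintervals of the unit
    interval. *)
Lemma packing_premeasure_at_le (s t : R) N m : 0 <= t < s -> (N <= m)%N ->
  (forall n, (N <= n)%N -> (phi n)%:R <= t * n%:R) ->
  (packing_premeasure_at s X (2 ^- m)
     <= (2 `^ s * 2 `^ t * (2 ^- m) `^ (s - t))%:E)%E.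
Proof.
move=> /andP[t0 ts] Nm HN; have s0 : 0 < s by exact: le_lt_trans ts.
apply: ge_ereal_sup => _ [D [c [r [Dcr disj ->]]]].
have /choice[I HI] : forall i, exists I : set (measurableTypeR R), D i ->
    [/\ measurable I,
    forall u, I u -> 0 <= u < 1 /\ closed_ball (c i) (r i) (coded R phi (digit u)) &
    ((r i `^ t)%:E <= (2 `^ t)%:E * lebesgue_measure I)%E].
  move=> i; have [Di|nDi] := pselect (D i); last by exists set0.
  have [Xc /andP[r0 rm]] := Dcr i Di.
  have rN : 0 < r i <= 2 ^- N by rewrite r0 (le_trans rm)// dyadic_le.
  by have [I HI] := cylinder_into_ball t0 Xc rN HN; exists I.
set C := 2 `^ s * 2 `^ t * _.
have C0 : 0 <= C by rewrite /C !mulr_ge0// powR_ge0.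
apply: (@le_trans _ _ (\esum_(i in D) (C%:E * lebesgue_measure (I i)))%E).
  apply: le_esum => i Di; have [_ /andP[r0 rm]] := Dcr i Di.
  have [_ _ rI] := HI i Di.
  rewrite diameter_closed_ball// poweR_EFin powRM ?(ltW r0)//.
  have -> : r i `^ s = r i `^ (s - t) * r i `^ t.
    by rewrite -powRD ?subrK// gt_eqF// implybT.
  rewrite /C (mulrAC (2 `^ s)) [X in (_ <= X * _)%E]EFinM -muleA.
  apply: le_trans (lee_wpmul2l _ rI); last first.
    by rewrite lee_fin mulr_ge0// powR_ge0.
  rewrite -EFinM lee_fin mulrA ler_wpM2r ?powR_ge0// ler_wpM2l ?powR_ge0//.
  by apply: ge0_ler_powR => //; rewrite ?nnegrE ?subr_ge0 ltW// invr_gt0 exprn_gt0.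
rewrite (esumZl _ C0) => [|i]; last exact: measure_ge0.
rewrite -[leRHS]mule1; apply: lee_wpmul2l; first by rewrite lee_fin.
have tI : trivIset D I.
  move=> i j Di Dj [u [Iu Ju]]; apply: disj => //.
  have [_ Bi _] := HI i Di; have [_ Bj _] := HI j Dj.
  by exists (coded R phi (digit u)); split; [case: (Bi u Iu)|case: (Bj u Ju)].
have mI i : D i -> measurable (I i) by move=> /HI[].
rewrite -(lebesgue_unit R).
have := measure_bigcup lebesgue_measure D I mI tI.
rewrite nneseries_esum; last by move=> i _; exact: measure_ge0.
rewrite set_mem_set => <-.
by apply: lebesgue_outer_subset => u [i Di Iu]; have [_ Bi _] := HI i Di; case: (Bi u Iu).
Qed.

Lemma packing_measure_eq0 (s t : R) : 0 <= t < s ->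
  (exists N, forall n, (N <= n)%N -> (phi n)%:R <= t * n%:R) ->
  packing_measure s X = 0%E.
Proof.
move=> ts [N HN]; have P0 : packing_premeasure s X = 0%E.
  apply/eqP; rewrite eq_le packing_premeasure_ge0 andbT.
  apply/lee_addgt0Pr => e e0; rewrite add0e packing_premeasureE.
  have st : 0 < s - t by rewrite subr_gt0; case/andP: ts.
  have [M HM] := powR2_unbounded (2 `^ s * 2 `^ t / e) st.
  apply: (le_trans (ereal_inf_lbound _)).
    by exists (2 ^- maxn N M) => //=; rewrite invr_gt0 exprn_gt0.
  apply: (le_trans (packing_premeasure_at_le ts (leq_maxl _ _) HN)).
  rewrite lee_fin dyadic_powR powRN ler_pdivrMr ?powR_gt0// [leRHS]mulrC -ler_pdivrMr//.
  by rewrite (mulrC _ (s - t)); apply: HM; exact: leq_maxr.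
apply/eqP; rewrite eq_le; apply/andP; split.
  apply: ereal_inf_lbound; exists (fun=> X); first by move=> x Xx; exists 0%N.
  by rewrite eseries0.
apply: le_ereal_inf_tmp => _ [G _ <-]; apply: nneseries_ge0 => i _ _.
exact: packing_premeasure_ge0.
Qed.

(** Greedy choice: as long as the balls around the points already chosen do
    not carry the mass of [G], there is a further point of [G] outside
    them. *)
Lemma separated_points (G : set R) n M :
  ((M%:R * (5 / 2 ^+ phi n))%:E < mass G)%E ->
  exists c : nat -> R, (forall i, (i <= M)%N -> G (c i)) /\
    forall i j, (i < j <= M)%N -> 2 ^- n.+1 < `|c i - c j|.
Proof.
elim: M => [|M IH] MG.
  rewrite mul0r in MG.
  have [[x Gx]|G0] := pselect (G !=set0).
    by exists (fun=> x); split=> // i j; lia.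
  move: MG; rewrite (_ : G = set0) ?code_mass0 ?ltxx//.
  by apply/seteqP; split=> // x Gx; apply: G0; exists x.
have [|c [Gc csep]] := IH.
  by rewrite (le_lt_trans _ MG)// lee_fin ler_wpM2r ?divr_ge0 ?exprn_ge0// ler_nat.
pose B i := [set y | `|c i - y| <= 2 ^- n.+1].
have [x [Gx Bx]] : exists x, G x /\ forall i, (i <= M)%N -> ~ B i x.
  apply: contrapT => /forallNP noX.
  have GB : G `<=` \bigcup_(i in `I_M.+1) B i.
    move=> x Gx; have /not_andP[//|/existsNP[i /not_implyP[iM /contrapT Bi]]] := noX x.
    by exists i.
  have : (mass G <= (M.+1%:R * (5 / 2 ^+ phi n))%:E)%E.
    apply: (le_trans (code_mass_esum phi GB)).
    apply: esum_ordinal_le => i; first exact: code_mass_ge0.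
    move=> _; apply: code_mass_small => //; apply: diameter_le.
      by rewrite invr_ge0 exprn_ge0.
    move=> y y'; rewrite /B /= !ler_norml.
    have -> : (2 ^- n : R) = 2 * 2 ^- n.+1 by rewrite exprS; field; rewrite expf_neq0.
    by move: (2 ^- n.+1) => d; lra.
  by rewrite leNgt MG.
exists (fun j => if j == M.+1 then x else c j); split=> [i iM|i j ij].
  by case: eqP => // iM1; apply: Gc; lia.
have iM : (i == M.+1) = false by lia.
rewrite iM; case: eqP => jM; last by apply: csep; lia.
have := Bx i; rewrite /B /= => /(_ _)/negP; rewrite -ltNge; apply; lia.
Qed.

(** At a scale where [phi n >= t * n], separated points give at least a
    constant times [2 ^ phi n] disjoint balls of diameter [2 ^- n.+1], whose
    [s]-th powers add up to a multiple of [2 ^ ((t - s) * n)]. *)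
Lemma packing_premeasure_at_ge1 (G : set R) (s t d : R) : 0 <= s < t ->
  (forall N, exists2 n, (N <= n)%N & t * n%:R <= (phi n)%:R) ->
  (0 < mass G)%E -> 0 < d -> (1 <= packing_premeasure_at s G d)%E.
Proof.
move=> /andP[s0 st] freq G0 d0.
have Gfin : mass G \is a fin_num.
  by rewrite ge0_fin_numE ?code_mass_ge0// (le_lt_trans (code_mass_le1 _ _))// ltry.
pose m := fine (mass G).
have m0 : 0 < m by rewrite fine_gt0// G0 -ge0_fin_numE ?code_mass_ge0.
have [k kd] := exists_dyadic_le d0.
have ts : 0 < t - s by rewrite subr_gt0.
have [N HN] := powR2_unbounded (10 / m * 2 `^ s) ts.
have [n nN phin] := freq (maxn k N).
have p0 : 0 < 2 ^+ phi n :> R by rewrite exprn_gt0.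
(* With the 10 the balls around [M] points carry at most half the mass of
   [G]. *)
pose M := Num.truncn (m * 2 ^+ phi n / 10).
have /andP[Mlo Mhi] : M%:R <= m * 2 ^+ phi n / 10 < M.+1%:R.
  by apply: truncn_itv; rewrite divr_ge0// mulr_ge0// ltW.
have [|c [Gc csep]] := @separated_points G n M.
  rewrite -(fineK Gfin) lte_fin -/m mulrA ltr_pdivrMr//.
  by have : 0 < m * 2 ^+ phi n by [rewrite mulr_gt0]; lra.
apply: (le_trans _ (ereal_sup_ubound _)); last first.
  exists `I_M.+1, c, (fun=> 2 ^- n.+2); split; last by [].
  - move=> i iM; split; first by apply: Gc.
    by rewrite invr_gt0 exprn_gt0//= (le_trans _ kd)// dyadic_le; lia.
  - have sep i j y : (i < j <= M)%N -> closed_ball (c i) (2 ^- n.+2) y ->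
        closed_ball (c j) (2 ^- n.+2) y -> False.
      move=> /csep; rewrite !closed_ballP ?invr_gt0 ?exprn_gt0//=.
      have -> : (2 ^- n.+1 : R) = 2 * 2 ^- n.+2.
        by rewrite (exprS _ n.+1); field; rewrite expf_neq0.
      move: (2 ^- n.+2) => e; rewrite !ler_norml ltr_normr; lra.
    move=> i j /= iM jM [y [yi yj]]; have [ij|ji|//] := ltngtP i j.
    + by exfalso; apply: (sep i j y) => //; lia.
    + by exfalso; apply: (sep j i y) => //; lia.
rewrite esum_ordinal; last by move=> i; exact: poweR_ge0.
have -> : (\sum_(i < M.+1) diameter (closed_ball (c i) (2 ^- n.+2)) `^ s =
    (M.+1%:R * (2 ^- n.+1) `^ s)%:E)%E.
  rewrite (eq_bigr (fun=> ((2 ^- n.+1) `^ s)%:E)) => [|i _].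
    by rewrite sumEFin sumr_const card_ord mulr_natl.
  rewrite diameter_closed_ball ?invr_gt0 ?exprn_gt0// poweR_EFin.
  by congr (_ `^ _)%:E; rewrite (exprS _ n.+1); field; rewrite expf_neq0.
rewrite lee_fin dyadic_powR powRN ler_pdivlMr ?powR_gt0// mul1r.
apply: (le_trans _ (ltW Mhi)).
have -> : n.+1%:R * s = s + s * n%:R by rewrite -natr1; ring.
have h1 := HN n (leq_trans (leq_maxr _ _) nN).
have h2 : 2 `^ ((t - s) * n%:R) * 2 `^ (s * n%:R) <= 2 ^+ phi n :> R.
  rewrite -powRD ?pnatr_eq0 ?implybT// -powR_mulrn//.
  by apply: ler_powR; [rewrite ler1n|rewrite -mulrDl subrK].
rewrite powRD ?pnatr_eq0 ?implybT//.
rewrite [leRHS]mulrAC -ler_pdivrMl ?divr_gt0// invf_div mulrA.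
by apply: le_trans h2; rewrite ler_pM2r ?powR_gt0.
Qed.

(** In a countable cover of the set, a member of positive mass already has
    premeasure at least 1. *)
Lemma packing_measure_neq0 (s t : R) : 0 <= s < t ->
  (forall N, exists2 n, (N <= n)%N & t * n%:R <= (phi n)%:R) ->
  packing_measure s X <> 0%E.
Proof.
move=> st freq P0; have : (packing_measure s X < 1)%E by rewrite P0 lte01.
move=> /ereal_inf_lt[_ [G XG <-]]; apply/negP; rewrite -leNgt.
have [i Gi] := code_mass_gt0_of_cover XG.
rewrite nneseries_esumT => [|j]; last exact: packing_premeasure_ge0.
apply: esum_ge; exists [set i]; first by split.
rewrite fsbig_set1 packing_premeasureE; apply: le_ereal_inf_tmp => _ [d d0 <-].
exact: packing_premeasure_at_ge1 st freq Gi d0.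
Qed.

End PackingDimension.

(** * All dimensions of a coded set *)

Lemma ereal_real_between (R : realType) (x y : \bar R) : (x < y)%E ->
  exists2 t : R, (x < t%:E)%E & (t%:E < y)%E.
Proof.
case: x => [x| |]; case: y => [y| |] //.
- rewrite lte_fin => xy; exists ((x + y) / 2); rewrite lte_fin; lra.
- by move=> _; exists (x + 1); [rewrite lte_fin; lra|exact: ltry].
- by move=> _; exists (y - 1); [exact: ltNyr|rewrite lte_fin; lra].
- by move=> _; exists 0; [exact: ltNyr|exact: ltry].
Qed.

Lemma lee_of_real_above (R : realType) (x y : \bar R) :
  (forall t : R, (y < t%:E)%E -> (x <= t%:E)%E) -> (x <= y)%E.
Proof.
move=> h; rewrite leNgt; apply/negP => /ereal_real_between[t yt].
by rewrite ltNge h.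
Qed.

Lemma lee_of_real_below (R : realType) (x y : \bar R) :
  (forall t : R, (t%:E < x)%E -> (t%:E <= y)%E) -> (x <= y)%E.
Proof.
move=> h; rewrite leNgt; apply/negP => /ereal_real_between[t yt].
by move=> /h; rewrite leNgt yt.
Qed.

Lemma limn_einf_lt_frequently (R : realType) (u : nat -> \bar R) (t : R) :
  (limn_einf u < t%:E)%E -> forall K, exists2 k, (K <= k)%N & (u k <= t%:E)%E.
Proof.
move=> ut K; have : (ereal_inf (u @` [set k | (K <= k)%N]) < t%:E)%E.
  apply: le_lt_trans ut; rewrite [leRHS](limf_einfE u \oo).
  by apply: ereal_sup_ubound; exists [set k | (K <= k)%N] => //; exists K.
by move=> /ereal_inf_lt[_ [k Kk <-] /ltW ukt]; exists k.
Qed.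

Lemma limn_einf_gt_eventually (R : realType) (u : nat -> \bar R) (t : R) :
  (t%:E < limn_einf u)%E -> exists K, forall k, (K <= k)%N -> (t%:E <= u k)%E.
Proof.
rewrite [ltRHS](limf_einfE u \oo) => /ereal_sup_gt[_ [V [K _ KV] <-] /ltW tV].
exists K => k Kk; apply: (le_trans tV); apply: ereal_inf_lbound.
by exists k => //; exact: KV.
Qed.

Lemma limn_esup_gt_frequently (R : realType) (u : nat -> \bar R) (t : R) :
  (t%:E < limn_esup u)%E -> forall K, exists2 k, (K <= k)%N & (t%:E <= u k)%E.
Proof.
move=> ut K; have : (t%:E < ereal_sup (u @` [set k | (K <= k)%N]))%E.
  apply: lt_le_trans ut _; rewrite /limn_esup limf_esupE.
  by apply: ereal_inf_lbound; exists [set k | (K <= k)%N] => //; exists K.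
by move=> /ereal_sup_gt[_ [k Kk <-] /ltW ukt]; exists k.
Qed.

Lemma limn_esup_lt_eventually (R : realType) (u : nat -> \bar R) (t : R) :
  (limn_esup u < t%:E)%E -> exists K, forall k, (K <= k)%N -> (u k <= t%:E)%E.
Proof.
rewrite /limn_esup limf_esupE => /ereal_inf_lt[_ [V [K _ KV] <-] /ltW tV].
exists K => k Kk; apply: le_trans tV; apply: ereal_sup_ubound.
by exists k => //; exact: KV.
Qed.

Section CodedDimensions.
Variables (R : realType) (phi : nat -> nat) (phiP : unit_step phi).
Local Notation X := (range (coded R phi)).

(** The hypotheses say that [L] is the lower limit of [phi n / n]. Covers
    bound the box dimension from above, positive mass bounds the modified one
    from below, and the latter is at most the former; the Hausdorff dimension
    is bounded on both sides directly. *)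
Lemma coded_lower_dims (L : \bar R) :
  (forall t : R, (L < t%:E)%E ->
    forall N, exists2 n, (N <= n)%N & (phi n)%:R <= t * n%:R) ->
  (forall t : R, (t%:E < L)%E ->
    exists N, forall n, (N <= n)%N -> t * n%:R <= (phi n)%:R) ->
  [/\ hausdorff_dim X = L, lower_modified_box_dim X = L & lower_box_dim X = L].
Proof.
move=> above below.
have above0 t : (L < t%:E)%E -> 0 <= t.
  move=> /above/(_ 1%N)[n n1 phin]; rewrite -(pmulr_lge0 (x := n%:R)) ?ltr0n//.
  exact: le_trans phin.
have ubox : (lower_box_dim X <= L)%E.
  by apply: lee_of_real_above => t /above; exact: lower_box_dim_le.
have lbox G : bounded_set G -> (0 < code_mass phi G)%E -> (L <= lower_box_dim G)%E.
  move=> bG G0; apply: lee_of_real_below => t' t'L.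
  have [t'0|t'0] := ltP t' 0.
    by apply: (@lower_box_dim_ge _ _ phiP G 0) => //; exists 0%N => n _; rewrite mul0r.
  have [t t't tL] := ereal_real_between t'L; rewrite lte_fin in t't.
  by apply: (lower_box_dim_ge phiP bG G0 _ t't (below t tL)); rewrite (le_trans t'0)// ltW.
have mbox : (L <= lower_modified_box_dim X)%E by exact: modified_dim_ge lbox.
have mbox' := @modified_dim_le R phi (@lower_box_dim R).
split; last 2 first.
- by apply/eqP; rewrite eq_le mbox (le_trans mbox').
- by apply/eqP; rewrite eq_le ubox (le_trans mbox).
apply/eqP; rewrite eq_le; apply/andP; split.
- apply: lee_of_real_above => s Ls; apply: ereal_inf_lbound; exists s => //=.
  have [t Lt ts] := ereal_real_between Ls; rewrite lte_fin in ts.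
  by split; [exact: above0|exact: hausdorff_measure_eq0 (above0 _ Ls) ts (above t Lt)].
- apply: le_ereal_inf_tmp => _ [s [s0 Hs] <-]; apply: lee_of_real_below => t tL.
  rewrite leNgt; apply/negP; rewrite lte_fin => st.
  by apply: (hausdorff_measure_neq0 phiP _ (below t tL) Hs); rewrite s0.
Qed.

(** The hypotheses say that [L] is the upper limit of [phi n / n]; the
    dimensions are compared as for the lower limit. *)
Lemma coded_upper_dims (L : \bar R) :
  (forall t : R, (L < t%:E)%E ->
    exists N, forall n, (N <= n)%N -> (phi n)%:R <= t * n%:R) ->
  (forall t : R, (t%:E < L)%E ->
    forall N, exists2 n, (N <= n)%N & t * n%:R <= (phi n)%:R) ->
  [/\ packing_dim X = L, upper_modified_box_dim X = L & upper_box_dim X = L].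
Proof.
move=> above below.
have above0 t : (L < t%:E)%E -> 0 <= t.
  move=> /above[N /(_ N.+1 (leqnSn N)) phin].
  rewrite -(pmulr_lge0 (x := N.+1%:R)) ?ltr0n//.
  exact: le_trans phin.
have ubox : (upper_box_dim X <= L)%E.
  apply: lee_of_real_above => t' /ereal_real_between[t Lt tt'].
  by apply: (upper_box_dim_le phiP _ (above t Lt)); rewrite above0//= -lte_fin.
have lbox G : bounded_set G -> (0 < code_mass phi G)%E -> (L <= upper_box_dim G)%E.
  move=> bG G0; apply: lee_of_real_below => t' /ereal_real_between[t t't tL].
  by apply: (upper_box_dim_ge phiP bG G0 _ (below t tL)); rewrite -lte_fin.
have mbox : (L <= upper_modified_box_dim X)%E by exact: modified_dim_ge lbox.
have mbox' := @modified_dim_le R phi (@upper_box_dim R).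
split; last 2 first.
- by apply/eqP; rewrite eq_le mbox (le_trans mbox').
- by apply/eqP; rewrite eq_le ubox (le_trans mbox).
apply/eqP; rewrite eq_le; apply/andP; split.
- apply: lee_of_real_above => s Ls; apply: ereal_inf_lbound; exists s => //=.
  have [t Lt ts] := ereal_real_between Ls; rewrite lte_fin in ts.
  split; first exact: above0.
  by apply: packing_measure_eq0 (above t Lt) => //; rewrite above0.
- apply: le_ereal_inf_tmp => _ [s [s0 Hs] <-]; apply: lee_of_real_below => t tL.
  rewrite leNgt; apply/negP; rewrite lte_fin => st.
  by apply: (packing_measure_neq0 phiP _ (below t tL) Hs); rewrite s0.
Qed.

End CodedDimensions.

(** * Free and constant blocks of digits *)

(** The [j]-th digit has to equal the preceding one. The first digit of each
    constant block is free, whence [b i + 1]. *)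
Definition repeated (a b : nat -> int) (j : nat) : Prop :=
  exists2 i : nat, (1 <= i)%N & b i + 1 < j%:Z <= a i.+1.

Fixpoint choices (a b : nat -> int) (n : nat) : nat :=
  if n is m.+1 then (choices a b m + ~~ `[< repeated a b n >])%N else 0%N.

Section Blocks.
Variables a b : nat -> int.
Hypothesis ha1 : a 1%N = 0.
Hypothesis hab1 : a 1%N <= b 1%N.
Hypothesis hba : forall i : nat, (1 <= i)%N -> b i < a i.+1.
Hypothesis hab : forall i : nat, (2 <= i)%N -> a i < b i.
Local Notation phi := (choices a b).
Local Notation S := (free_digits a b).

Lemma le_block i : (1 <= i)%N -> a i <= b i.
Proof. by case: i => [//|[//|i]] _; apply/ltW/hab. Qed.

Lemma a_homo i k : (1 <= i <= k)%N -> a i <= a k.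
Proof.
elim: k => [|k IH]; first lia.
move=> /andP[i1]; rewrite leq_eqVlt => /orP[/eqP->//|ik].
have k1 : (1 <= k)%N by lia.
have aik : a i <= a k by apply: IH; lia.
by have := le_block k1; have := hba k1; lia.
Qed.

Lemma a_ge i : i%:Z <= a i.+1.
Proof.
elim: i => [|i IH]; first by rewrite ha1.
have := le_block (i := i.+1) isT; have := hba (i := i.+1) isT; lia.
Qed.

Lemma a_ge0 k : (1 <= k)%N -> 0 <= a k.
Proof. by case: k => // k _; have := a_ge k; lia. Qed.

Lemma b_ge i : (1 <= i)%N -> i%:Z <= b i + 1.
Proof. by case: i => // i i1; have := a_ge i; have := le_block i1; lia. Qed.

Lemma repeated_block k j : (1 <= k)%N -> b k + 1 < j%:Z <= a k.+1 -> repeated a b j.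
Proof. by exists k. Qed.

Lemma free_block k j : (1 <= k)%N -> a k < j%:Z <= b k + 1 -> ~ repeated a b j.
Proof.
move=> k1 jk [i i1 ij]; have [ki|ik] := leqP k i.
  have : b k <= b i.
    have [->//|nki] := eqVneq k i.
    have : a k.+1 <= a i by apply: a_homo; lia.
    by have := hba k1; have := le_block i1; lia.
  lia.
have : a i.+1 <= a k by apply: a_homo; lia.
lia.
Qed.

Lemma choices_free k n : (1 <= k)%N -> a k <= n%:Z <= b k + 1 ->
  (phi n)%:Z = (phi `|a k|)%:Z + (n%:Z - a k).
Proof.
move=> k1; elim: n => [|n IH] nk.
  by have -> : a k = 0 by [have := a_ge0 k1; lia].
have [an|an] := eqVneq (a k) n.+1%:Z; first by rewrite an subrr addr0.
rewrite [phi n.+1]/= asboolF; last by apply: (free_block k1); lia.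
by have := IH; lia.
Qed.

Lemma choices_repeated k n : (1 <= k)%N -> b k + 1 <= n%:Z <= a k.+1 ->
  (phi n)%:Z = (phi `|b k + 1|)%:Z.
Proof.
move=> k1; elim: n => [|n IH] nk.
  by have := le_block k1; have := a_ge0 k1; lia.
have [an|an] := eqVneq (b k + 1) n.+1%:Z; first by rewrite an.
rewrite [phi n.+1]/= asboolT; last by apply: (repeated_block k1); lia.
by rewrite /= addn0; apply: IH; lia.
Qed.

Lemma free_digitsS k : S k.+1 = S k + (b k.+1 - a k.+1 + 1).
Proof. by rewrite /free_digits big_nat_recr. Qed.

(** Each block contributes its [b k - a k] free digits, and one more for the
    common value of the following constant block. *)
Lemma choices_end k : (phi `|a k.+1|)%:Z = S k.
Proof.
elim: k => [|k IH]; first by rewrite ha1 /free_digits big_geq.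
rewrite free_digitsS -IH.
have h1 := hba (i := k.+1) isT; have h2 := le_block (i := k.+1) isT.
have h0 := a_ge k.
rewrite (@choices_repeated k.+1)//; last lia.
by rewrite (@choices_free k.+1)//; lia.
Qed.

Lemma choices_in_free_block k n : (1 <= k)%N -> a k <= n%:Z <= b k + 1 ->
  (phi n)%:Z = S k - (b k + 1 - n%:Z).
Proof.
case: k => // k k1 nk; rewrite (choices_free k1 nk) choices_end.
by rewrite free_digitsS; lia.
Qed.

Lemma choices_in_repeated_block k n : (1 <= k)%N -> b k + 1 <= n%:Z <= a k.+1 ->
  (phi n)%:Z = S k.
Proof.
move=> k1 nk; rewrite (choices_repeated k1 nk) -choices_end.
by rewrite -[LHS](@choices_repeated k `|a k.+1|)//; have := a_ge k; have := hba k1; lia.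
Qed.

Lemma choices_unit_step : unit_step phi.
Proof.
split=> [//||n /=]; last by case: asbool; lia.
rewrite /= asboolF//; apply: (@free_block 1) => //; lia.
Qed.

Lemma locate_block n : (1 <= n)%N -> exists2 k, (1 <= k)%N & a k < n%:Z <= a k.+1.
Proof.
elim: n => // n IH _; have [n0|n0] := posnP n.
  by exists 1%N; rewrite // n0 ha1; have := a_ge 1; lia.
have [k k1 nk] := IH n0; have [nk'|nk'] := leP n.+1%:Z (a k.+1).
  by exists k => //; lia.
by exists k.+1 => //; have := hba (i := k.+1) isT; have := le_block (i := k.+1) isT; lia.
Qed.

Lemma locate_block_ge K n : (1 <= n)%N -> a K.+1 < n%:Z ->
  exists2 k, (K < k)%N & a k < n%:Z <= a k.+1.
Proof.
move=> n1 Kn; have [k k1 nk] := locate_block n1; exists k => //.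
rewrite ltnNge; apply/negP => kK.
have : a k.+1 <= a K.+1 by apply: a_homo; lia.
lia.
Qed.

(** Two positions have the same count exactly when all the digits after the
    first of them, up to the second, are repeated. *)
Lemma constant_blocksP xi : constant_blocks a b xi <->
  forall m n, (1 <= m)%N -> (1 <= n)%N -> phi m = phi n -> xi m = xi n.
Proof.
split=> [cst|inj i i1 m n im in']; last first.
  have b0 := le_block i1; have a0 := a_ge0 i1.
  apply: inj; [lia|lia|].
  by apply/eqP; rewrite -eqz_nat !(choices_in_repeated_block i1)//; lia.
have main m d : (1 <= m)%N -> phi (m + d) = phi m -> xi (m + d)%N = xi m.
  move=> m1; elim: d => [|d IH]; first by rewrite addn0.
  have [_ _ st] := choices_unit_step.
  have := unit_step_homo choices_unit_step (leq_addr d m); have := st (m + d)%N.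
  rewrite addnS => st' le eq; have {}IH : xi (m + d)%N = xi m by apply: IH; lia.
  rewrite -IH; move: eq st' le => /=; case: asboolP => [[i i1 ij] _ _ _|_ /=]; last lia.
  by apply: (cst i i1); lia.
move=> m n m1 n1 e; have [mn|nm] := leqP m n.
  by rewrite -(subnKC mn) main// subnKC.
by rewrite -(subnKC (ltnW nm)) main// subnKC// ltnW.
Qed.

(** A sequence that is constant on the fibres of the count factors through
    it. *)
Lemma Xprime_coded (R : realType) : Xprime R a b = range (coded R phi).
Proof.
apply/seteqP; split=> [_ [xi /constant_blocksP cst ->]|_ [z _ <-]]; last first.
  by exists (z \o phi) => //; apply/constant_blocksP => m n _ _ /= ->.
(* The bit with number [j] is the common digit of the positions with count
   [j]. *)
exists (fun j => `[< exists n, [/\ (1 <= n)%N, phi n = j & xi n] >]) => //.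
apply: (congr1 (fun s : nat -> R => limn s)); apply/funext => N.
apply: eq_big_nat => n /andP[n1 _]; congr (_%:R / _); congr nat_of_bool.
apply/idP/idP => [/asboolP[m [m1 mn xm]]|xn]; first by rewrite -(cst m n).
by apply/asboolP; exists n.
Qed.

Section Asymptotics.
Variables (R : realType) (t : R).
Local Notation u k := ((S k)%:~R / (a k.+1)%:~R : R).
Local Notation v k := ((S k)%:~R / (b k)%:~R : R).

Lemma free_digits_ge0 k : 0 <= S k.
Proof. by rewrite -choices_end. Qed.

Lemma choices_int n : (phi n)%:R = (phi n)%:Z%:~R :> R.
Proof. by []. Qed.

Lemma a_gt0 k : (1 <= k)%N -> 0 < (a k.+1)%:~R :> R.
Proof. by move=> k1; rewrite ltr0z; have := a_ge k; lia. Qed.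

Lemma choices_liminf_le :
  (forall K, exists2 k, (K <= k)%N & ((u k)%:E <= t%:E)%E) ->
  forall N, exists2 n, (N <= n)%N & (phi n)%:R <= t * n%:R.
Proof.
move=> freq N; have [k Nk] := freq N.+1; have k1 : (1 <= k)%N by lia.
rewrite lee_fin ler_pdivrMr ?a_gt0// => uk; have ak := a_ge k.
exists `|a k.+1|%N; first lia.
rewrite choices_int choices_end (le_trans uk)//.
by rewrite natr_absz ger0_norm//; lia.
Qed.

(** The ratio is at least [t] at the ends of the constant blocks. It decreases
    on a constant block, so it is at least [t] inside one; on a free block
    [phi] grows with slope 1, which is at least [t]. *)
Lemma choices_liminf_ge :
  (exists K, forall k, (K <= k)%N -> (t%:E <= (u k)%:E)%E) ->
  exists N, forall n, (N <= n)%N -> t * n%:R <= (phi n)%:R.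
Proof.
move=> [K HK]; have {}HK k : (K < k)%N -> t * (a k.+1)%:~R <= (S k)%:~R.
  move=> Kk; have := HK k (ltnW Kk).
  by rewrite lee_fin ler_pdivlMr ?a_gt0//; lia.
have t1 : t <= 1.
  have K1 : (1 <= K.+1)%N by [].
  rewrite -(ler_pM2r (a_gt0 K1)) mul1r (le_trans (HK K.+1 _))//.
  rewrite ler_int -choices_end; have := unit_step_le choices_unit_step `|a K.+2|.
  by have := a_ge K.+1; lia.
exists `|a K.+2|.+1 => n Kn.
have aK := a_ge K.+1.
have [||k Kk nk] := @locate_block_ge K.+1 n; [lia|lia|].
have k1 : (1 <= k)%N by lia.
have [nb|bn] := leP n%:Z (b k + 1); last first.
  rewrite choices_int (@choices_in_repeated_block k)//; last lia.
  have na : n%:R <= (a k.+1)%:~R :> R by rewrite -[n%:R]/(n%:Z%:~R) ler_int; lia.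
  have [t0|t0] := leP 0 t; last first.
    apply: (@le_trans _ _ 0); first by rewrite mulr_le0_ge0// ltW.
    by rewrite ler0z free_digits_ge0.
  by apply: le_trans (HK k (ltnW Kk)); rewrite ler_wpM2l.
rewrite choices_int (@choices_free k)//; last lia.
case: k Kk nk k1 nb => // k Kk nk k1 nb.
rewrite choices_end rmorphD rmorphB /=.
have := HK k Kk.
have : (a k.+1)%:~R <= n%:R :> R by rewrite -[n%:R]/(n%:Z%:~R) ler_int; lia.
rewrite -[n%:Z%:~R]/(n%:R).
nra.
Qed.

(** Uses position [b k + 1], where the count is exactly [free_digits a b k];
    replacing [b k] by [b k + 1] costs the difference between [t] and [t']. *)
Lemma choices_limsup_ge t' : t' < t ->
  (forall K, exists2 k, (K <= k)%N & (t%:E <= (v k)%:E)%E) ->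
  forall N, exists2 n, (N <= n)%N & t' * n%:R <= (phi n)%:R.
Proof.
move=> t't freq N; pose M := (Num.truncn (t / (t - t'))).+1.
have [k Nk] := freq (maxn N M).+2; have k2 : (2 <= k)%N by lia.
have k1 := ltnW k2; have bk := b_ge k1.
have b0 : 0 < (b k)%:~R :> R by rewrite ltr0z; lia.
rewrite lee_fin ler_pdivlMr// => vk.
have nE : (absz (b k + 1))%:R = (b k)%:~R + 1 :> R.
  by rewrite natr_absz ger0_norm ?rmorphD//; lia.
exists (absz (b k + 1)); first lia.
rewrite choices_int (@choices_in_repeated_block k)//; last by have := hba k1; lia.
apply: le_trans vk; rewrite nE.
have Mb : t / (t - t') <= (b k)%:~R + 1.
  rewrite -nE (le_trans (ltW (truncnS_gt _)))// ler_nat -/M; lia.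
move: Mb; rewrite ler_pdivrMr ?subr_gt0//; nra.
Qed.

(** On a constant block the count stays at its initial value
    [free_digits a b k] while [n] grows; on a free block, going back from
    [b k], the count decreases with slope 1, which is at least [t] unless the
    trivial bound [phi n <= n] suffices. *)
Lemma choices_limsup_le :
  (exists K, forall k, (K <= k)%N -> ((v k)%:E <= t%:E)%E) ->
  exists N, forall n, (N <= n)%N -> (phi n)%:R <= t * n%:R.
Proof.
move=> [K HK]; have b0 k : (2 <= k)%N -> 0 < (b k)%:~R :> R.
  by move=> k2; rewrite ltr0z; have := b_ge (ltnW k2); lia.
have {}HK k : (maxn K 2 <= k)%N -> (S k)%:~R <= t * (b k)%:~R.
  move=> Kk; have := HK k (leq_trans (leq_maxl _ _) Kk).
  by rewrite lee_fin ler_pdivrMr// b0//; lia.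
have t0 : 0 <= t.
  rewrite -(pmulr_lge0 _ (b0 (maxn K 2) (leq_maxr _ _))).
  by apply: le_trans (HK _ (leqnn _)); rewrite ler0z free_digits_ge0.
exists `|a (maxn K 2).+1|.+1 => n Kn.
have aK := a_ge (maxn K 2).
have [||k Kk nk] := @locate_block_ge (maxn K 2) n; [lia|lia|].
have k1 : (1 <= k)%N by lia.
have Hk := HK k (ltnW Kk).
have [nb|bn] := leP n%:Z (b k); last first.
  rewrite choices_int (@choices_in_repeated_block k)//; last lia.
  apply: (le_trans Hk); rewrite ler_wpM2l//.
  by rewrite -[n%:R]/(n%:Z%:~R) ler_int; lia.
have [t1|/ltW t1] := leP t 1; last first.
  apply: (@le_trans _ _ n%:R); last by rewrite ler_peMl.
  by rewrite ler_nat; exact: unit_step_le choices_unit_step n.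
rewrite choices_int (@choices_in_free_block k)//; last lia.
rewrite rmorphB rmorphB rmorphD /= -[n%:Z%:~R]/(n%:R).
have : n%:R <= (b k)%:~R :> R by rewrite -[n%:R]/(n%:Z%:~R) ler_int.
nra.
Qed.

End Asymptotics.
End Blocks.

Theorem theorem2p8 (R : realType) (a b : nat -> int)
    (ha1 : a 1%N = 0)
    (hab1 : a 1%N <= b 1%N)
    (hba : forall i : nat, (1 <= i)%N -> b i < a i.+1)
    (hab : forall i : nat, (2 <= i)%N -> a i < b i) :
  [/\ hausdorff_dim (Xprime R a b) = lower_modified_box_dim (Xprime R a b),
      lower_modified_box_dim (Xprime R a b) = lower_box_dim (Xprime R a b) &
      lower_box_dim (Xprime R a b) =
        limn_einf (fun k : nat =>
          ((free_digits a b k)%:~R / (a k.+1)%:~R : R)%:E)]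
  /\
  [/\ packing_dim (Xprime R a b) = upper_modified_box_dim (Xprime R a b),
      upper_modified_box_dim (Xprime R a b) = upper_box_dim (Xprime R a b) &
      upper_box_dim (Xprime R a b) =
        limn_esup (fun k : nat =>
          ((free_digits a b k)%:~R / (b k)%:~R : R)%:E)].
Proof.
have step := choices_unit_step ha1 hab1 hba hab.
rewrite Xprime_coded//; split.
- have [|| -> -> ->] := @coded_lower_dims R _ step (limn_einf (fun k : nat =>
    ((free_digits a b k)%:~R / (a k.+1)%:~R : R)%:E)).
  + move=> t /limn_einf_lt_frequently; exact: choices_liminf_le.
  + move=> t /limn_einf_gt_eventually; exact: choices_liminf_ge.
  + by [].
- have [|| -> -> ->] := @coded_upper_dims R _ step (limn_esup (fun k : nat =>
    ((free_digits a b k)%:~R / (b k)%:~R : R)%:E)).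
  + move=> t /limn_esup_lt_eventually; exact: choices_limsup_le.
  + move=> t' /ereal_real_between[t t't /limn_esup_gt_frequently].
    by apply: choices_limsup_ge => //; rewrite -lte_fin.
  + by [].
Qed.
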